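(* For every $\epsilon>0$, an $N\times N$ HBM switch operated by the Parallel Frame Interleaving (PFI) algorithm, whose memory components are given a speedup of $1+\epsilon$ and which is allowed to use this speedup to clear leftover packets using padded frames, can mimic the behavior of a FIFO output-queued shared-memory switch.
   Context: Ideal switch and mimicking. A FIFO output-queued (OQ) shared-memory switch is a switch in which all incoming packets arrive directly at the egress (their output) and are serviced in order. The HBM switch mimics the OQ shared-memory switch if there exists a fixed delay $D$ such that, if both switches get the same packets at the same times and some packet exits the OQ shared-memory switch at time $t$, then it leaves the HBM switch before time $t+D$. Both the shared-memory switch and the HBM switch are assumed to have infinite (HBM) buffer sizes. A speedup of $1+\epsilon$ for the memory components means that the memories of the switch operate at $1+\epsilon$ times their baseline rates given below. A padded frame is a frame formed from fewer than $K$ bytes of packet data for one output by filling the remainder with padding. The HBM switch. It has $N$ inputs and $N$ outputs, each of data rate $P$. It consists of $N$ input-port SRAMs, a tail SRAM made of $N$ SRAM modules, a group of High-Bandwidth Memory (HBM) stacks with $T$ parallel channels and $L$ banks per channel, a head SRAM made of $N$ SRAM modules, and $N$ output-port SRAMs. All stages have matching memory speeds: at baseline (no speedup), the $N$ input-port SRAMs together, the tail SRAM, the HBM group and the head SRAM each support writing at total rate $N P$ and reading at total rate $N P$. Small read/write transition delays of the HBM are treated as part of the baseline rate. Banks are partitioned into $L/\gamma$ disjoint bank interleaving groups of $\gamma$ consecutive banks. A batch has $k$ bytes ($N$ divides $k$), a frame has $K$ bytes ($k$ divides $K$), and $K=\gamma\,T\,S$, where $S$ is the segment size (amount written to one bank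 of one channel at a time). The PFI algorithm. (1) Input ports: variable-size packets arriving at an input are stored in $N$ per-output queues and packed into fixed-size batches of $k$ bytes (a packet may straddle two batches). Formed batches for all outputs join a FIFO queue at that input. The head-of-line batch is cut into $N$ slices of $k/N$ bytes, and an $N\times N$ crossbar performing a fixed cyclic rotation between inputs and tail SRAM modules sends each slice to a different tail SRAM module, always starting from the first module. (2) Tail SRAM: each module has $N$ per-output queues of batch slices. When a per-output queue of a module reaches $K/k$ batch slices, these form a frame slice (all modules do so for the same frame in a staggered way); frame slices for all outputs are then stored in a shared FIFO queue. (3) HBM writes: frames are written into per-output FIFO regions of the HBM. The $n$-th frame for a given output is written into bank interleaving group $n \bmod (L/\gamma)$, by writing a segment of size $S$ on each of the $T$ channels in parallel, successively into the $\gamma$ consecutive banks of the group. (4) HBM reads: the HBM is read cyclically over the $N$ outputs, one frame per output, in FIFO order for each output. (5) Head SRAM: each of the $N$ modules receives a slice of each frame, cuts it into batch slices stored in per-output queues, and these are sent to the outputs through a second $N\times N$ cyclic crossbar. (6) Output ports: received batches are cut back into variable-length packets, which depart.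
   Formalization: Packet lengths are assumed bounded by an arbitrary maximum, on which the fixed delay D may depend; with unbounded variable-size packets no fixed D exists, since a long packet holds up the next packet of its input in the batch FIFO. *)

(* Defs.v *)
From HB Require Import structures.
From mathcomp Require Import all_boot all_order all_algebra.
From mathcomp Require Import reals.

Set Implicit Arguments.
Unset Strict Implicit.
Unset Printing Implicit Defensive.

Import Order.TTheory GRing.Theory Num.Theory.
Local Open Scope ring_scope.

Record config (R : realType) := Config {
  cN : nat;     (* number of inputs and of outputs, N *)
  cP : R;       (* data rate of one input or output, P, in bytes per time unit *)
  ck : nat;     (* bytes per batch, k *)
  cK : nat;     (* bytes per frame, K *)
  cT : nat;     (* HBM channels, T *)
  cL : nat;     (* banks per channel, L *)
  cgam : nat;   (* banks per bank interleaving group, gamma *)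
  cS : nat      (* bytes per segment, S *)
}.

Record config_ok (R : realType) (c : config R) : Prop := ConfigOk {
  okN : (0 < cN c)%N;
  okP : 0 < cP c;
  okk : (0 < ck c)%N;
  okNk : (cN c %| ck c)%N;
  okK : (0 < cK c)%N;
  okkK : (ck c %| cK c)%N;
  okKS : cK c = (cgam c * cT c * cS c)%N;
  okL : (0 < cL c)%N;
  okgL : (cgam c %| cL c)%N
}.

(* [seqno] numbers the packets of one input, so that two packets of the same
   length and destination remain distinct. *)
Record packet (N : nat) := Packet {
  src : 'I_N; seqno : nat; dst : 'I_N; len : nat
}.

Definition packet_tuple N (p : packet N) := (src p, seqno p, dst p, len p).
Definition tuple_packet N (u : 'I_N * nat * 'I_N * nat) : packet N :=
  let: (i, n, j, l) := u in Packet i n j l.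
Lemma packet_tupleK N : cancel (@packet_tuple N) (@tuple_packet N).
Proof. by case. Qed.
HB.instance Definition _ N := Equality.copy (packet N)
  (can_type (@packet_tupleK N)).

Section Traffic.
Variables (R : realType) (c : config R).
Let N := cN c.

(* A packet with the time at which its last byte has been received. *)
Definition arrival := (R * packet N)%type.

(* [tr i n] is the [n]-th packet of input [i], or [None] when input [i]
   receives at most [n] packets; the traffic may be finite or infinite. *)
Definition traffic := 'I_N -> nat -> option arrival.

(* Packet [p] received at [t] occupies its input line, of rate P, during
   [t - len p / P, t]; these periods are disjoint and start after time 0. *)
Record traffic_ok (Lmax : nat) (tr : traffic) : Prop := TrafficOk {
  tr_id : forall i n a, tr i n = Some a -> src a.2 = i /\ seqno a.2 = n;
  tr_len : forall i n a, tr i n = Some a -> (0 < len a.2 <= Lmax)%N;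
  tr_first : forall i a, tr i 0%N = Some a -> (len a.2)%:R / cP c <= a.1;
  tr_next : forall i n b, tr i n.+1 = Some b ->
    exists2 a, tr i n = Some a & a.1 + (len b.2)%:R / cP c <= b.1
}.

(* Packets have at least one byte, so that at most P * t of them can be
   received by time t on one input: see [mem_arrived]. *)
Definition arrived (tr : traffic) (i : 'I_N) (t : R) : seq arrival :=
  [seq a <- pmap (tr i) (iota 0 (Num.truncn (cP c * t))) | a.1 <= t].

Lemma mem_arrived Lmax tr i t a : 0 < cP c -> traffic_ok Lmax tr ->
  a \in arrived tr i t <-> (exists2 n, tr i n = Some a & a.1 <= t).
Proof.
move=> P0 ok; rewrite mem_filter mem_pmap.
split=> [/andP[at_ /mapP[n _ trn]]|[n trn at_]]; first by exists n.
rewrite at_; apply/mapP; exists n => //.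
suff na : n.+1%:R / cP c <= a.1.
  rewrite mem_iota /= add0n truncn_gt_nat.
  by rewrite mulrC -ler_pdivrMr // (le_trans na).
elim: n a {at_} trn => [|n IH] a trn.
  apply: le_trans (tr_first ok trn); rewrite ler_pM2r ?invr_gt0 // ler_nat.
  by have /andP[] := tr_len ok trn.
have [b trb] := tr_next ok trn; apply: le_trans.
rewrite -addn1 natrD mulrDl lerD ?IH //.
rewrite ler_pM2r ?invr_gt0 // ler_nat.
by have /andP[] := tr_len ok trn.
Qed.

(* FIFO order; simultaneous arrivals are ordered by input number. *)
Definition fifo_le (a b : arrival) : bool :=
  (a.1 < b.1) || (a.1 == b.1) && (src a.2 <= src b.2)%N.

(* The packets for the output of [a] up to and including [a] itself. *)
Definition oq_upto (tr : traffic) (a : arrival) : seq arrival :=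
  sort fifo_le
    [seq b <- flatten [seq arrived tr i a.1 | i <- enum 'I_N]
       | (dst b.2 == dst a.2) && fifo_le b a].

Definition serve (free : R) (a : arrival) : R :=
  Num.max free a.1 + (len a.2)%:R / cP c.

(* The time at which the last byte of [a] leaves on its output line. *)
Definition oq_exit (tr : traffic) (a : arrival) : R :=
  foldl serve 0 (oq_upto tr a).

End Traffic.

(* The switch is synchronous.  A time slot is the time a tail or head SRAM
   module needs to read or write one batch slice of k/N bytes, at the memory
   rate (1 + eps) * P of one module.  Writing or reading one frame of K bytes in
   the HBM, at rate (1 + eps) * N * P, then takes exactly K/k slots, called a
   window.  In slot [s] every stage acts on the state left by slot [s - 1]. *)

Section Switch.
Variables (R : realType) (c : config R) (eps : R).
Let N := cN c.
Let P := cP c.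
Let k := ck c.
Let K := cK c.
Let G := (cL c %/ cgam c)%N.   (* number of bank interleaving groups *)
Let W := (K %/ k)%N.           (* batches per frame; slots per window *)
Let ks := (k %/ N)%N.          (* bytes per batch slice *)
Let Ks := (K %/ N)%N.          (* bytes per frame slice *)

Definition slot_time : R := k%:R / ((1 + eps) * N%:R * P).

(* Byte number [b] of packet [p] is [Some (p, b)]; [None] is a padding byte. *)
Definition cell := option (packet N * nat).

Definition pad_cells (n : nat) (q : seq cell) : seq cell :=
  q ++ nseq (n - size q) None.

Definition cells_of (p : packet N) : seq cell :=
  [seq Some (p, b) | b <- iota 0 (len p)].

Definition batch := ('I_N * seq cell)%type.        (* output, k bytes *)
Definition slice := seq cell.                      (* k/N bytes *)
Definition frame_slice := ('I_N * seq slice)%type. (* output, K/k slices *)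
Definition frame := ('I_N * seq cell)%type.        (* output, K bytes *)

Record in_port := InPort {
  ip_q : 'I_N -> seq cell;      (* per-output queues *)
  ip_fifo : seq batch;          (* formed batches, for all outputs *)
  ip_tx : option batch          (* batch traversing the first crossbar *)
}.

Record tail_module := TailModule {
  tm_q : 'I_N -> seq slice;     (* per-output queues *)
  tm_fifo : seq frame_slice     (* shared queue of frame slices *)
}.

Record hbm_group := Hbm {
  (* [hb_mem ch b j r] is the [r]-th segment of the region of output [j] in
     bank [b] of channel [ch]; rows are unbounded. *)
  hb_mem : 'I_(cT c) -> 'I_(cL c) -> 'I_N -> nat -> seq cell;
  hb_nw : 'I_N -> nat;          (* frames written, per output *)
  hb_nr : 'I_N -> nat;          (* frames read or being read, per output *)
  hb_w : option frame;          (* frame being written *)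
  hb_r : option frame           (* frame being read *)
}.

Record out_port := OutPort {
  op_on : bool;                 (* a batch is traversing the second crossbar *)
  op_rx : seq cell;             (* part of it already received *)
  op_buf : seq (packet N * nat);      (* bytes of incomplete packets *)
  op_free : R;                  (* when the line has sent all complete packets *)
  op_sent : seq (packet N * R)  (* complete packets, with departure times *)
}.

Record state := State {
  st_in : 'I_N -> in_port;
  st_tail : 'I_N -> tail_module;
  (* frame padding decisions of the last N slots, the latest first *)
  st_flush : seq ('I_N -> bool);
  st_hbm : hbm_group;
  st_head : 'I_N -> 'I_N -> seq slice;  (* module, output *)
  st_out : 'I_N -> out_port
}.

Definition init : state := State
  (fun _ => InPort (fun _ => [::]) [::] None)
  (fun _ => TailModule (fun _ => [::]) [::])
  [::]
  (Hbm (fun _ _ _ _ => [::]) (fun _ => 0%N) (fun _ => 0%N) None None)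
  (fun _ _ => [::])
  (fun _ => OutPort false [::] [::] 0 [::]).

(* When to clear leftovers, from the slot number and the current state only:
   [pad_batch s st i j] pads the incomplete batch of input [i] for output [j],
   [pad_frame s st j] pads the incomplete frame of the tail SRAM for output
   [j].  Empty queues are never padded. *)
Record policy := Policy {
  pad_batch : nat -> state -> 'I_N -> 'I_N -> bool;
  pad_frame : nat -> state -> 'I_N -> bool
}.

Definition accept (qf : ('I_N -> seq cell) * seq batch) (p : packet N) :=
  let: (q, f) := qf in
  let x := q (dst p) ++ cells_of p in
  let n := (size x %/ k)%N in
  ((fun j => if j == dst p then drop (n * k) x else q j),
   f ++ [seq (dst p, b) | b <- reshape (nseq n k) x]).

Definition flush_batches (fl : 'I_N -> bool)
    (qf : ('I_N -> seq cell) * seq batch) :=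
  let: (q, f) := qf in
  let padded j := fl j && (q j != [::]) in
  ((fun j => if padded j then [::] else q j),
   f ++ [seq (j, pad_cells k (q j)) | j <- enum 'I_N & padded j]).

(* In slot [s] the first crossbar connects input [i] to tail module
   (i + s) mod N, hence input [i] takes a new batch for slot [s + 1] when
   (i + s + 1) mod N is the first module. *)
Definition in_step (s : nat) (i : 'I_N) (new : seq (packet N))
    (fl : 'I_N -> bool) (x : in_port) : in_port :=
  let load := ((i + s.+1) %% N == 0)%N in
  let f := if load then behead (ip_fifo x) else ip_fifo x in
  let: (q', f') := flush_batches fl (foldl accept (ip_q x, f) new) in
  InPort q' f' (if load then ohead (ip_fifo x) else ip_tx x).

Definition batch_slice (m : nat) (b : batch) : slice :=
  take ks (drop (m * ks) b.2).

Definition tail_rx (s : nat) (st : state) (m : 'I_N) : option ('I_N * slice) :=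
  if [pick i : 'I_N | ((i + s) %% N == m)%N] is Some i then
    omap (fun b : batch => (b.1, batch_slice m b)) (ip_tx (st_in st i))
  else None.

(* Padding slices complete a frame slice that has fewer than K/k slices. *)
Definition tail_step (rx : option ('I_N * slice)) (fl : 'I_N -> bool)
    (pop : bool) (x : tail_module) : tail_module :=
  let q j := if rx is Some (j', sl) then
               if j == j' then rcons (tm_q x j) sl else tm_q x j
             else tm_q x j in
  let ready j := (size (q j) == W) || (fl j && (q j != [::])) in
  let fill v := v ++ nseq (W - size v) (nseq ks None) in
  TailModule (fun j => if ready j then [::] else q j)
    ((if pop then behead (tm_fifo x) else tm_fifo x)
       ++ [seq (j, fill (q j)) | j <- enum 'I_N & ready j]).

Definition boundary (s : nat) : bool := (s %% W == 0)%N.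

(* A frame leaves the tail SRAM once every module has its slice of it. *)
Definition hbm_pop (s : nat) (st : state) : bool :=
  boundary s && [forall m : 'I_N, tm_fifo (st_tail st m) != [::]].

Definition head_frame (st : state) : option frame :=
  let slices := pmap (fun m => ohead (tm_fifo (st_tail st m))) (enum 'I_N) in
  omap (fun x : frame_slice => (x.1, flatten [seq flatten y.2 | y <- slices]))
       (ohead slices).

Definition group_banks (n : nat) : seq 'I_(cL c) :=
  [seq b <- enum 'I_(cL c) | (nat_of_ord b %/ cgam c == n %% G)%N].

(* Write, on all channels, the segments of frame number [n] that belong to
   bank [b]. *)
Definition write_bank (n : nat) (fr : frame)
    (mem : 'I_(cT c) -> 'I_(cL c) -> 'I_N -> nat -> seq cell)
    (b : 'I_(cL c)) :=
  fun (ch : 'I_(cT c)) (b' : 'I_(cL c)) (j : 'I_N) (r : nat) =>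
    if [&& b' == b, j == fr.1 & r == (n %/ G)%N] then
      take (cS c) (drop (((b %% cgam c) * cT c + ch) * cS c) fr.2)
    else mem ch b' j r.

Definition write_frame (n : nat) (fr : frame) mem :=
  foldl (write_bank n fr) mem (group_banks n).

Definition read_frame
    (mem : 'I_(cT c) -> 'I_(cL c) -> 'I_N -> nat -> seq cell)
    (j : 'I_N) (n : nat) : frame :=
  (j, flatten [seq mem ch b j (n %/ G)%N
                 | b <- group_banks n, ch <- enum 'I_(cT c)]).

(* At a window boundary the frames in transit are completed and the next ones
   are started.  The output read in a window is given by the cyclic order; its
   turn is lost when it has no frame in the HBM. *)
Definition hbm_step (s : nat) (st : state) : hbm_group :=
  let h := st_hbm st in
  if ~~ boundary s then h else
  let mem' := if hb_w h is Some fr then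
                write_frame (hb_nw h fr.1) fr (hb_mem h) else hb_mem h in
  let nw' j := (hb_nw h j +
                (if hb_w h is Some fr then fr.1 == j else false))%N in
  let turn := [pick j : 'I_N |
                 ((s %/ W) %% N == j)%N && (hb_nr h j < hb_nw h j)%N] in
  Hbm mem' nw' (fun j => (hb_nr h j + (turn == Some j))%N)
    (if hbm_pop s st then head_frame st else None)
    (omap (fun j => read_frame (hb_mem h) j (hb_nr h j)) turn).

Definition frame_slices (m : nat) (fr : frame) : seq slice :=
  reshape (nseq W ks) (take Ks (drop (m * Ks) fr.2)).

(* In slot [s] the second crossbar connects output [j] to head module
   (j + s) mod N; a batch starts at the first module. *)
Definition sending (s : nat) (st : state) (j : 'I_N) : option 'I_N :=
  [pick m : 'I_N | ((j + s) %% N == m)%N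
                   && (if m == 0%N :> nat then st_head st m j != [::]
                       else op_on (st_out st j))].

Definition head_step (s : nat) (st : state) (m j : 'I_N) : seq slice :=
  let q := st_head st m j in
  (if sending s st j == Some m then behead q else q)
    ++ (if boundary s then
          if hb_r (st_hbm st) is Some fr then
            if fr.1 == j then frame_slices m fr else [::]
          else [::]
        else [::]).

(* Padding is dropped.  A packet whose bytes have all been received by time [t]
   is sent on the line, of rate P, after the previous packets. *)
Definition receive (t : R) (x : out_port) (u : cell) : out_port :=
  if u is Some pb then
    let p := pb.1 in
    let buf := rcons (op_buf x) pb in
    if all (fun b => (p, b) \in buf) (iota 0 (len p)) then
      let d := Num.max (op_free x) t + (len p)%:R / P in
      OutPort (op_on x) (op_rx x) [seq v <- buf | v.1 != p] d
        (rcons (op_sent x) (p, d))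
    else OutPort (op_on x) (op_rx x) buf (op_free x) (op_sent x)
  else x.

Definition out_step (s : nat) (st : state) (j : 'I_N) : out_port :=
  let x := st_out st j in
  if sending s st j is Some m then
    let rx := op_rx x ++ head [::] (st_head st m j) in
    if m.+1 == N then
      foldl (receive (s.+1%:R * slot_time))
        (OutPort false [::] (op_buf x) (op_free x) (op_sent x)) rx
    else OutPort true rx (op_buf x) (op_free x) (op_sent x)
  else x.

(* The decision to pad frames reaches tail module [m] with a delay of [m]
   slots, exactly as the slices of one batch do. *)
Definition step (pol : policy) (s : nat) (new : 'I_N -> seq (packet N))
    (st : state) : state :=
  let fls := pad_frame pol s st :: st_flush st in
  State
    (fun i => in_step s i (new i) (pad_batch pol s st i) (st_in st i))
    (fun m => tail_step (tail_rx s st m) (nth (fun _ => false) fls m)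
                (hbm_pop s st) (st_tail st m))
    (take N fls)
    (hbm_step s st)
    (head_step s st)
    (out_step s st).

(* Slot [s] lasts from s * slot_time to (s + 1) * slot_time; the packets it
   takes in are those received since the beginning of slot [s - 1]. *)
Definition new_packets (tr : traffic c) (s : nat) (i : 'I_N) : seq (packet N) :=
  [seq a.2 | a <- arrived tr i (s%:R * slot_time)
           & (s%:R - 1) * slot_time < a.1].

Fixpoint run (pol : policy) (tr : traffic c) (n : nat) : state :=
  if n is s.+1 then step pol s (new_packets tr s) (run pol tr s) else init.

Definition hbm_exits (pol : policy) (tr : traffic c) (p : packet N) (d : R) :=
  exists n, (p, d) \in op_sent (st_out (run pol tr n) (dst p)).

(* The delay [D] is the same for all traffics with packets of at most [Lmax]
   bytes.  Without such a bound no fixed delay exists: a long packet holds up, at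
   its input, the next packet of that input for another output. *)
Definition mimics_oq (pol : policy) (Lmax : nat) : Prop :=
  exists D : R, forall tr : traffic c, traffic_ok Lmax tr ->
    forall i n a, tr i n = Some a ->
    exists2 d, hbm_exits pol tr a.2 d & d < oq_exit tr a + D.

End Switch.

(* Main.v *)
(** Every incomplete batch and frame is padded once every [M] slots, with [M] so large
    that traffic and padding together stay below the rates of the sped-up memories.
    The queues in front of the HBM are then bounded, and a packet is in the HBM a
    bounded time after its arrival.  Let [x0] be the last slot before that at which
    the HBM had no frame for its output.  From [x0] on, frames for the output are read
    back to back, and they hold little more than the bytes received since [x0]
    and the padding; the speedup absorbs the padding, and the output-queued switch
    needs the time to send the same bytes at rate [P].  Hence the packet is complete
    at its output port a bounded time after it leaves the output-queued switch.

    Completed packets may still wait for the output line.  The packets sent since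
    the line was last idle were all completed after that time, hence left the
    output-queued switch no earlier than a bounded time before it.  Except for a
    bounded number of bytes received after the packet, they also left that switch
    before the packet did, which bounds their total length. *)

(* The obstacle is the skew of the pipeline: a batch is spread over [N] modules that receive their
   slices in different slots, and a frame is scattered over banks and channels. The estimates are
   therefore made on an unsliced machine in which a queue is a growing log with a counter of
   departures. Older logs are prefixes of newer ones, so a lagging module merely reads an older log,
   and the refinement shows that the output ports receive exactly the batches of this machine. As
   the policy ignores the state, the padding slots are known in advance.

   Backlogs come from one fact about periodic servers: arrivals at no more than the service rate, up
   to a burst, leave a bounded backlog. It applies to the inputs, the tail SRAM and the head SRAM,
   but not to the HBM: all inputs may send to one output, whose frames then accumulate without
   bound. Only there is the comparison with the output-queued switch needed, which builds up the
   same backlog. All bursts and delays are expressions in the configuration, [eps], [M] and [Lmax],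
   never in the traffic, as a fixed delay requires. *)
Require Import Defs.
From mathcomp Require Import all_boot all_order all_algebra.
From mathcomp Require Import reals.
From mathcomp Require Import zify ring lra.
Import Order.TTheory GRing.Theory Num.Theory.
Local Open Scope ring_scope.

Set Implicit Arguments.
Unset Strict Implicit.
Unset Printing Implicit Defensive.

(** * Queues served periodically *)

(** Up to an additive constant, the number of events of [periodic q r] before [n]. *)
Definition tick (q r n : nat) : nat := ((n + r + q.-1) %/ q)%N.

Definition periodic (q r : nat) : pred nat := fun n => (q %| n + r)%N.

(** The items served before slot [n] by a queue into which [A n] items have been
    put before slot [n], when each event of [ev] serves one item if it can. *)
Fixpoint served (ev : pred nat) (A : nat -> nat) (n : nat) : nat :=
  if n is s.+1 then (served ev A s + (ev s && (served ev A s < A s)))%N else 0%N.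

(** Models transfers that last a whole window: what is started at one boundary is complete at the
    next, so the number of completed transfers is the value that the number of started ones had at
    the last boundary. *)
Fixpoint latch (ev : pred nat) (A : nat -> nat) (n : nat) : nat :=
  if n is s.+1 then (if ev s then A s else latch ev A s) else 0%N.

Section Served.
Local Open Scope nat_scope.
Variables (q r : nat).
Hypothesis q0 : 0 < q.

Lemma tickS n : tick q r n.+1 = tick q r n + periodic q r n.
Proof.
rewrite /tick /periodic.
have -> : n.+1 + r + q.-1 = (n + r + q.-1).+1 by lia.
rewrite divnS // addnC; congr (_ + nat_of_bool _).
have -> : (n + r + q.-1).+1 = n + r + q by lia.
by rewrite dvdn_addl.
Qed.

Lemma tick_mono x y : x <= y -> tick q r x <= tick q r y.
Proof. by move=> xy; apply: leq_div2r; rewrite !leq_add2r. Qed.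

Lemma tick_lb x y : x <= y -> q * tick q r x + y <= q * tick q r y + x + q.
Proof.
rewrite /tick => xy; set a := x + r + q.-1; set b := y + r + q.-1.
have := divn_eq a q; have := divn_eq b q.
have := ltn_pmod a q0; have := ltn_pmod b q0.
rewrite (mulnC (_ %/ _)) (mulnC (a %/ _)).
move: (a %% q) (b %% q) (q * (a %/ q)) (q * (b %/ q)); rewrite /a /b; lia.
Qed.

Lemma tick_ub x y : x <= y -> q * tick q r y + x <= q * tick q r x + y + q.
Proof.
rewrite /tick => xy; set a := x + r + q.-1; set b := y + r + q.-1.
have := divn_eq a q; have := divn_eq b q.
have := ltn_pmod a q0; have := ltn_pmod b q0.
rewrite (mulnC (_ %/ _)) (mulnC (a %/ _)).
move: (a %% q) (b %% q) (q * (a %/ q)) (q * (b %/ q)); rewrite /a /b; lia.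
Qed.

Lemma tickDq n : tick q r (n + q) = (tick q r n).+1.
Proof.
rewrite /tick; have -> : n + q + r + q.-1 = n + r + q.-1 + q by lia.
by rewrite divnDr // divnn q0 addn1.
Qed.

Lemma periodic_next n : exists2 d, d < q & periodic q r (n + d).
Proof.
suff: forall m, tick q r n < tick q r (n + m) ->
    exists2 d, d < m & periodic q r (n + d).
  by move=> /(_ q); rewrite tickDq; apply.
elim=> [|m IH]; first by rewrite addn0 ltnn.
rewrite addnS tickS; have [pm _|_] := boolP (periodic q r (n + m)).
  by exists m.
by rewrite addn0 => /IH[d dm pd]; exists d => //; lia.
Qed.

Lemma served_mono ev A x y : x <= y -> served ev A x <= served ev A y.
Proof.
by move=> xy; rewrite -(subnKC xy); elim: (y - x) => [|d IH]; rewrite ?addn0 // addnS;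
  apply: leq_trans IH _; exact: leq_addr.
Qed.

Lemma served_tick A x y : x <= y ->
  served (periodic q r) A y + tick q r x <= served (periodic q r) A x + tick q r y.
Proof.
move=> xy; rewrite -(subnKC xy); elim: (y - x) => [|d IH]; first by rewrite addn0.
rewrite addnS tickS /=; move: IH; case: (periodic _ _ _) => /=; last by lia.
by case: ltnP; lia.
Qed.

Variable A : nat -> nat.
Hypothesis A_mono : forall x y, x <= y -> A x <= A y.
Let S := served (periodic q r) A.
Let SS n : S n.+1 = S n + (periodic q r n && (S n < A n)). Proof. by []. Qed.

Lemma served_le n : S n <= A n.
Proof.
elim: n => //= n IH; have := A_mono (leqnSn n).
rewrite SS; case: ltnP; rewrite ?(andbT, andbF); last by lia.
by case: (periodic _ _ _) => /=; lia.
Qed.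

(** Busy-period argument: for [n > 0], [x] is the last slot before [n] with an empty queue. After it
    every event serves an item; only an event in slot [x] itself can be idle, hence the [+ 1]. *)
Lemma served_last_empty n : A 0 = 0 ->
  exists2 x, x <= n & S x = A x /\ S x + tick q r n <= S n + tick q r x + 1.
Proof.
move=> A0; elim: n => [|n [x xn [SA Sx]]]; first by exists 0 => //; split; rewrite ?A0 ?leq_addr.
have := served_le n; rewrite leq_eqVlt => /orP[/eqP eS|lS].
  exists n => //; split=> //; rewrite tickS SS eS ltnn andbF.
  by case: (periodic _ _ _); lia.
exists x; [by lia|split=> //]; rewrite tickS SS lS andbT; lia.
Qed.

(** As long as something that was present at [n] is still waiting, no event is idle. *)
Lemma served_progress n d :
  A n <= S (n + d) \/ S n + tick q r (n + d) <= S (n + d) + tick q r n.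
Proof.
elim: d => [|d [IH|IH]]; first by right; rewrite addn0.
  by left; apply: leq_trans IH _; apply: served_mono; lia.
have := served_mono (periodic q r) A (leqnSn (n + d)); rewrite -addnS -/(S _).
have [?|lA] := leqP (A n) (S (n + d)); first by left; apply: leq_trans; eauto.
right; rewrite addnS tickS SS.
have -> : S (n + d) < A (n + d) by apply: leq_trans lA _; apply: A_mono; lia.
by rewrite andbT; lia.
Qed.

Lemma served_drain n b : A n <= S n + b -> A n <= S (n + q * b).
Proof.
move=> Ab; have [//|] := served_progress n (q * b).
suff -> : tick q r (n + q * b) = tick q r n + b by lia.
elim: b {Ab} => [|b IH]; first by rewrite muln0 !addn0.
have -> : n + q * b.+1 = n + q * b + q by rewrite mulnS; lia.
by rewrite tickDq IH addnS.
Qed.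

(** The hypothesis says that arrivals have rate at most [1 / q] up to a burst [C]. Since the last
    empty slot the events have kept up with them, apart from one idle event and the rounding of
    [tick], which cost [q] each. *)
Lemma served_backlog C : A 0 = 0 ->
  (forall x y, x <= y -> q * A y + x <= q * A x + y + C) ->
  forall n, A n <= S n + (C + 2 * q).
Proof.
move=> A0 lin n; have [x xn [SA Sx]] := served_last_empty n A0.
have := lin _ _ xn; have := tick_lb xn.
have : q * (S x + tick q r n) <= q * (S n + tick q r x + 1) by rewrite leq_pmul2l.
rewrite !mulnDr -SA => h1 h2 h3.
have h4 : q * A n <= q * S n + (C + 2 * q) by lia.
(* The sharper bound [(C + 2 * q) / q] is weakened so that no division occurs. *)
rewrite -(leq_pmul2l q0) mulnDr (leq_trans h4) // leq_add2l leq_pmull //.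
Qed.

End Served.

Section Latch.
Local Open Scope nat_scope.
Variables (q r : nat) (A : nat -> nat).
Hypothesis q0 : 0 < q.
Hypothesis A_mono : forall x y, x <= y -> A x <= A y.
Let L := latch (periodic q r) A.

Lemma latch_le n : L n <= A n.
Proof.
elim: n => //= n IH; apply: leq_trans (A_mono (leqnSn n)).
by rewrite /L /= -/(L n); case: ifP.
Qed.

Lemma latch_mono x y : x <= y -> L x <= L y.
Proof.
move=> xy; rewrite -(subnKC xy); elim: (y - x) => [|d IH]; rewrite ?addn0 // addnS.
apply: leq_trans IH _; rewrite /L /= -/(L _).
by case: ifP => // _; exact: latch_le.
Qed.

Lemma latch_lb n : A n <= L (n + q).
Proof.
have [d dq pd] := periodic_next r q0 n.
apply: (@leq_trans (L (n + d).+1)); last by apply: latch_mono; lia.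
by rewrite /L /= pd; apply: A_mono; lia.
Qed.

End Latch.

(** * The switch without its pipeline *)

#[local] Arguments accept {R c} qf p : simpl never.

Section Machine.
Local Open Scope nat_scope.
Variables (R : realType) (c : config R).
Variables (fl : pred nat) (new : nat -> 'I_(cN c) -> seq (packet (cN c))).
Local Notation N := (cN c).
Local Notation k := (ck c).
Local Notation K := (cK c).
Local Notation W := (cK c %/ ck c).

(** Instead of being removed from a queue, items stay in a log of all that ever
    entered it, and a counter tells how many have left.  Batches are not cut into
    slices and frames keep their list of batches. *)
Definition tframe := ('I_N * seq (seq (cell c)))%type.

Fixpoint inq (i : 'I_N) (n : nat) : ('I_N -> seq (cell c)) * seq (batch c) :=
  if n is s.+1 then
    flush_batches (fun=> fl s) (foldl (@accept R c) (inq i s) (new s i))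
  else (fun=> [::], [::]).

Definition inlog i n := (inq i n).2.

(** A batch is loaded in slot [n] for slot [n.+1], in which input [i] must face the first tail
    module: [N] divides [n + i.+1]. *)
Definition loaded (i : 'I_N) : nat -> nat :=
  served (periodic N i.+1) (fun n => size (inlog i n)).

Definition load (n : nat) : option (batch c) :=
  if [pick i : 'I_N | periodic N i.+1 n] is Some i
  then ohead (drop (loaded i n) (inlog i n)) else None.

Definition tail_in (rx : option (batch c)) (q : 'I_N -> seq (seq (cell c))) (j : 'I_N) :=
  if rx is Some b then if j == b.1 then rcons (q j) b.2 else q j else q j.

Definition tail_abs (rx : option (batch c)) (f : bool)
    (x : ('I_N -> seq (seq (cell c))) * seq tframe) :=
  let q := tail_in rx x.1 in
  let ready j := (size (q j) == W) || (f && (q j != [::])) in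
  let fill v := v ++ nseq (W - size v) (nseq k None) in
  (fun j => if ready j then [::] else q j,
   x.2 ++ [seq (j, fill (q j)) | j <- enum 'I_N & ready j]).

(** A batch is received here in the slot in which its input loads it; tail module
    [m] receives its slice [m.+1] slots later. *)
Fixpoint tailq (n : nat) : ('I_N -> seq (seq (cell c))) * seq tframe :=
  if n is s.+1 then tail_abs (load s) (fl s) (tailq s)
  else (fun=> [::], [::]).

Definition flog n := (tailq n).2.

(** A frame may leave once the last tail module holds its slice; that module lags [N] slots behind
    [tailq], hence [flog (n - N)]. *)
Definition popped : nat -> nat :=
  served (periodic W 0) (fun n => size (flog (n - N))).

Definition written : nat -> nat := latch (periodic W 0) popped.

Definition frames_of (j : 'I_N) (l : seq tframe) : seq (seq (seq (cell c))) :=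
  [seq f.2 | f <- l & f.1 == j].

Definition hbmq (j : 'I_N) n := frames_of j (take (written n) (flog n)).

(** [N * W] divides [n + (N - j) * W] exactly in the slots [n] at which the cyclic
    order reads output [j], see [turnE]. *)
Definition reads (j : 'I_N) : nat -> nat :=
  served (periodic (N * W) ((N - j) * W)) (fun n => size (hbmq j n)).

Definition delivered (j : 'I_N) : nat -> nat := latch (periodic W 0) (reads j).

Definition headlog (j : 'I_N) n : seq (seq (cell c)) :=
  flatten (take (delivered j n) (hbmq j n)).

Definition started (j : 'I_N) : nat -> nat :=
  served (periodic N j) (fun n => size (headlog j n)).

Hypothesis ok : config_ok c.
Let N0 : 0 < N := okN ok.
Let k0 : 0 < k := okk ok.
Let K0 : 0 < K := okK ok.
Let WkK : W * k = K. Proof. by rewrite divnK // okkK. Qed.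
Let W0 : 0 < W. Proof. by rewrite divn_gt0 // dvdn_leq // okkK. Qed.
Let NW0 : 0 < N * W. Proof. by rewrite muln_gt0 N0. Qed.

(** * Monotonicity of the logs and counters *)

Lemma prefix_mono T (l : nat -> seq T) (lS : forall n, exists s, l n.+1 = l n ++ s)
  x y : x <= y -> exists s, l y = l x ++ s.
Proof.
move=> xy; rewrite -(subnKC xy); elim: (y - x) => [|d [s IH]].
  by exists [::]; rewrite addn0 cats0.
have [s' e] := lS (x + d); exists (s ++ s').
by rewrite addnS e IH catA.
Qed.

(** Neither the queues nor the appended batches depend on what the FIFO already contains, so the log
    and the actual FIFO, from which batches have been removed, grow by the same suffix. *)
Lemma foldl_accept_cat q f l : exists g,
  (foldl (@accept R c) (q, f) l).2 = f ++ g /\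
  forall f', foldl (@accept R c) (q, f') l =
    ((foldl (@accept R c) (q, f) l).1, f' ++ g).
Proof.
elim: l q f => [|p l IH] q f /=; first by exists [::]; split=> [|f']; rewrite cats0.
have [q' [h e]] : exists q' h, forall f, accept (q, f) p = (q', f ++ h).
  by do 2 eexists.
have [g [e1 e2]] := IH q' (f ++ h); exists (h ++ g).
split=> [|f'].
  by rewrite e e1 catA.
by rewrite (e f') e2 e catA.
Qed.

Lemma inlog_prefix i x y : x <= y -> exists s, inlog i y = inlog i x ++ s.
Proof.
apply: prefix_mono => n; rewrite /inlog /=.
case: (inq i n) => q f /=; have [g [_ /(_ f) ->]] := foldl_accept_cat q [::] (new n i).
by rewrite /flush_batches /= -catA; eexists.
Qed.

Lemma flog_prefix x y : x <= y -> exists s, flog y = flog x ++ s.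
Proof. by apply: prefix_mono => n; rewrite /flog /=; eexists. Qed.

Lemma size_prefix T (l : nat -> seq T)
  (lp : forall x y, x <= y -> exists s, l y = l x ++ s) x y : x <= y ->
  size (l x) <= size (l y).
Proof. by move=> /lp[s ->]; rewrite size_cat leq_addr. Qed.

Lemma take_prefix T (l : nat -> seq T) (a : nat -> nat)
  (lp : forall x y, x <= y -> exists s, l y = l x ++ s)
  (am : forall x y, x <= y -> a x <= a y)
  (al : forall n, a n <= size (l n)) x y : x <= y ->
  exists s, take (a y) (l y) = take (a x) (l x) ++ s.
Proof.
move=> xy; have [s ->] := lp _ _ xy; exists (drop (a x) (take (a y) (l x ++ s))).
rewrite -{1}(cat_take_drop (a x) (take (a y) (l x ++ s))); congr (_ ++ _).
by rewrite take_takel ?am // takel_cat.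
Qed.

Lemma inlog_size_mono i x y : x <= y -> size (inlog i x) <= size (inlog i y).
Proof. exact/size_prefix/inlog_prefix. Qed.

Lemma loaded_le i n : loaded i n <= size (inlog i n).
Proof. exact/served_le/inlog_size_mono. Qed.

Lemma flog_size_mono x y : x <= y -> size (flog x) <= size (flog y).
Proof. exact/size_prefix/flog_prefix. Qed.

Lemma flogB_size_mono x y : x <= y -> size (flog (x - N)) <= size (flog (y - N)).
Proof. by move=> xy; apply: flog_size_mono; apply: leq_sub2r. Qed.

Lemma popped_le_sub n : popped n <= size (flog (n - N)).
Proof. exact/served_le/flogB_size_mono. Qed.

Lemma popped_le n : popped n <= size (flog n).
Proof. by apply: leq_trans (popped_le_sub n) _; apply/flog_size_mono/leq_subr. Qed.

Lemma popped_mono x y : x <= y -> popped x <= popped y.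
Proof. exact: served_mono. Qed.

Lemma written_mono x y : x <= y -> written x <= written y.
Proof. exact/latch_mono/popped_mono. Qed.

Lemma written_le_popped n : written n <= popped n.
Proof. exact/latch_le/popped_mono. Qed.

Lemma written_le n : written n <= size (flog n).
Proof. exact: leq_trans (written_le_popped n) (popped_le n). Qed.

Lemma hbmq_prefix j x y : x <= y -> exists s, hbmq j y = hbmq j x ++ s.
Proof.
move=> xy; have [s e] := take_prefix flog_prefix written_mono written_le xy.
by rewrite /hbmq e /frames_of filter_cat map_cat; eexists.
Qed.

Lemma hbmq_size_mono j x y : x <= y -> size (hbmq j x) <= size (hbmq j y).
Proof. exact/size_prefix/hbmq_prefix. Qed.

Lemma reads_le j n : reads j n <= size (hbmq j n).
Proof. exact/served_le/hbmq_size_mono. Qed.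

Lemma reads_mono j x y : x <= y -> reads j x <= reads j y.
Proof. exact: served_mono. Qed.

Lemma delivered_mono j x y : x <= y -> delivered j x <= delivered j y.
Proof. exact/latch_mono/reads_mono. Qed.

Lemma delivered_le_reads j n : delivered j n <= reads j n.
Proof. exact/latch_le/reads_mono. Qed.

Lemma delivered_le j n : delivered j n <= size (hbmq j n).
Proof. exact: leq_trans (delivered_le_reads j n) (reads_le j n). Qed.

Lemma headlog_prefix j x y : x <= y -> exists s, headlog j y = headlog j x ++ s.
Proof.
move=> xy; have [s e] := take_prefix (@hbmq_prefix j) (@delivered_mono j) (@delivered_le j) xy.
by rewrite /headlog e flatten_cat; eexists.
Qed.

Lemma headlog_size_mono j x y : x <= y -> size (headlog j x) <= size (headlog j y).
Proof. exact/size_prefix/headlog_prefix. Qed.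

Lemma started_le j n : started j n <= size (headlog j n).
Proof. exact/served_le/headlog_size_mono. Qed.

(** * Conservation of bytes *)

Definition bcount (P : pred (cell c)) j (l : seq (batch c)) : nat :=
  \sum_(b <- l | b.1 == j) count P b.2.

Definition fcount (P : pred (cell c)) j (l : seq tframe) : nat :=
  \sum_(f <- l | f.1 == j) count P (flatten f.2).

Lemma bcount_cat P j l1 l2 : bcount P j (l1 ++ l2) = bcount P j l1 + bcount P j l2.
Proof. by rewrite /bcount big_cat. Qed.

Lemma fcount_cat P j l1 l2 : fcount P j (l1 ++ l2) = fcount P j l1 + fcount P j l2.
Proof. by rewrite /fcount big_cat. Qed.

Definition in_ok (x : ('I_N -> seq (cell c)) * seq (batch c)) : Prop :=
  (forall j, size (x.1 j) < k) /\ all (fun b => size b.2 == k) x.2.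

Lemma size_reshape_nseq T (n m : nat) (v : seq T) :
  n * m <= size v -> all (fun u => size u == m) (reshape (nseq n m) v).
Proof.
elim: n v => //= n IH v h; have mv : m <= size v by lia.
by rewrite size_takel // eqxx IH // size_drop; lia.
Qed.

Lemma flatten_reshape_nseq T (n m : nat) (v : seq T) :
  n * m <= size v -> flatten (reshape (nseq n m) v) = take (n * m) v.
Proof.
elim: n v => [|n IH] v h /=; first by rewrite take0.
rewrite IH ?size_drop; last by lia.
by rewrite mulSn takeD.
Qed.

Lemma count_flatten T (P : pred T) (l : seq (seq T)) :
  count P (flatten l) = \sum_(v <- l) count P v.
Proof. by elim: l => [|v l IH]; rewrite ?big_nil //= big_cons count_cat IH. Qed.

Lemma accept_ok x p : in_ok x -> in_ok (accept x p).
Proof.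
case: x => q f [/= qk fk]; rewrite /accept; split=> /= [j|].
  case: eqP => // _; rewrite size_drop.
  by have := divn_eq (size (q (dst p) ++ cells_of p)) k; have := ltn_pmod (size (q (dst p) ++ cells_of p)) k0; lia.
rewrite all_cat fk all_map /=; set v := _ ++ _.
have := @size_reshape_nseq _ (size v %/ k) k v (leq_trunc_div _ _).
by apply: sub_all.
Qed.

Lemma accept_count P j x p : 
  bcount P j (accept x p).2 + count P ((accept x p).1 j) =
  bcount P j x.2 + count P (x.1 j) + (dst p == j) * count P (cells_of p).
Proof.
case: x => q f; rewrite /accept /= bcount_cat -addnA -addnA; congr (_ + _).
rewrite {1}/bcount big_map /= eq_sym; case: eqP => [->|_] /=; last first.
  by rewrite big_pred0_eq addn0.
rewrite mul1n -count_flatten flatten_reshape_nseq ?leq_trunc_div //.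
by rewrite -count_cat cat_take_drop count_cat.
Qed.

Lemma flush_ok f x : in_ok x -> in_ok (flush_batches f x).
Proof.
case: x => q l [/= qk lk]; rewrite /flush_batches; split=> /= [j|].
  by case: ifP.
rewrite all_cat lk all_map /=; apply/allP => j _ /=.
by rewrite /pad_cells size_cat size_nseq subnKC // ltnW.
Qed.

Lemma flush_count (f : 'I_N -> bool) x j : in_ok x -> exists2 z, z <= f j * k & forall P,
  bcount P j (flush_batches f x).2 + count P ((flush_batches f x).1 j) =
  bcount P j x.2 + count P (x.1 j) + P None * z.
Proof.
case: x => q l [/= qk lk]; rewrite /flush_batches /=.
pose padded j := f j && (q j != [::]); exists (padded j * (k - size (q j))).
  by rewrite /padded; case: (f j) => //=; case: (_ != _) => /=; lia.
move=> P; rewrite bcount_cat -!addnA; congr (_ + _).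
rewrite {1}/bcount big_map big_filter_cond big_enum_cond /=.
have [pj|npj] := boolP (padded j).
  rewrite (big_pred1 j) /=; last first.
    by move=> j' /=; rewrite andbC; case: eqP => // ->.
  by rewrite -/(padded j) pj /pad_cells count_cat count_nseq mul1n addn0.
rewrite -/(padded j) (negbTE npj) big_pred0 ?mul0n ?muln0 ?addn0 //.
by move=> j'; rewrite andbC; case: eqP => // -> /=; exact: negbTE.
Qed.

Lemma inq_ok i n : in_ok (inq i n).
Proof.
elim: n => [|n IH] /=; first by split.
apply: flush_ok; elim: (new n i) (inq i n) IH => //= p l IH x xk.
exact/IH/accept_ok.
Qed.

Definition incount P i j n := bcount P j (inlog i n) + count P ((inq i n).1 j).

Definition newcount P i j n :=
  \sum_(p <- new n i | dst p == j) count P (cells_of p).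

(** [z] counts the padding bytes and does not depend on [P]: sizes are obtained
    with [P = predT], and a given byte is followed with [P = pred1 (Some x)]. *)
Lemma incountS i j n : exists2 z, z <= fl n * k & forall P,
  incount P i j n.+1 = incount P i j n + newcount P i j n + P None * z.
Proof.
rewrite /incount /inlog /=; set x := inq i n.
have h l x0 : in_ok x0 -> in_ok (foldl (@accept R c) x0 l) /\ forall P,
    bcount P j (foldl (@accept R c) x0 l).2 + count P ((foldl (@accept R c) x0 l).1 j) =
    bcount P j x0.2 + count P (x0.1 j) + \sum_(p <- l | dst p == j) count P (cells_of p).
  elim: l x0 => [|p l IH] x0 x0k /=; first by split=> // P; rewrite big_nil addn0.
  have [? e] := IH _ (accept_ok p x0k); split=> // P.
  rewrite e accept_count big_cons -addnA; congr (_ + _).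
  by case: eqP; rewrite ?mul1n.
have [/(@flush_count (fun=> fl n)) fc e] := h (new n i) x (inq_ok i n).
have [z zk ez] := fc j; exists z => // P.
by rewrite ez e.
Qed.

Definition tail_ok (x : ('I_N -> seq (seq (cell c))) * seq tframe) : Prop :=
  (forall j, size (x.1 j) < W /\ all (fun v => size v == k) (x.1 j)) /\
  all (fun f : tframe => (size f.2 == W) && all (fun v => size v == k) f.2) x.2.

Lemma load_size n b : load n = Some b -> size b.2 = k.
Proof.
rewrite /load; case: pickP => // i _ e.
have := (inq_ok i n).2; rewrite -/(inlog i n) -(cat_take_drop (loaded i n) (inlog i n)).
rewrite all_cat => /andP[_]; move: e.
by case: (drop _ _) => //= b' l [->] /andP[/eqP].
Qed.

Lemma tail_in_ok rx q j : (forall b, rx = Some b -> size b.2 = k) ->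
  size (q j) < W -> all (fun v => size v == k) (q j) ->
  size (tail_in rx q j) <= W /\ all (fun v => size v == k) (tail_in rx q j).
Proof.
move=> rk qjW qjk; rewrite /tail_in.
case: rx rk => [b /(_ b erefl) bk|_]; last by split=> //; lia.
case: eqP => _; last by split=> //; lia.
by rewrite size_rcons all_rcons qjk bk eqxx.
Qed.

Lemma tail_abs_ok rx f x : (forall b, rx = Some b -> size b.2 = k) ->
  tail_ok x -> tail_ok (tail_abs rx f x).
Proof.
case: x => q l rk [/= qk lk]; rewrite /tail_abs; split=> /=.
  move=> j; have [vW vk] := tail_in_ok rk (qk j).1 (qk j).2.
  case: ifP => // /negbT; rewrite negb_or => /andP[vW' _]; split=> //; lia.
rewrite all_cat lk all_map /=; apply/allP => j _ /=.
have [vW vk] := tail_in_ok rk (qk j).1 (qk j).2.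
by rewrite size_cat size_nseq subnKC // eqxx all_cat vk all_nseq size_nseq eqxx orbT.
Qed.

Lemma tailq_ok n : tail_ok (tailq n).
Proof.
elim: n => [|n IH]; first by split.
by apply: tail_abs_ok IH => b; exact: load_size.
Qed.

Definition loadcount P j n : nat :=
  if load n is Some b then (b.1 == j) * count P b.2 else 0.

Definition tailcount P j n := fcount P j (flog n) + count P (flatten ((tailq n).1 j)).

Lemma tailcountS j n : exists2 z, z <= fl n * K & forall P,
  tailcount P j n.+1 = tailcount P j n + loadcount P j n + P None * z.
Proof.
rewrite /tailcount /flog /= /loadcount.
have := @load_size n; case: (tailq n) (tailq_ok n) => q l [/= qk lk].
move: (load n) => rx rk; rewrite /tail_abs /=.
set q' := tail_in rx q.
pose ready j := (size (q' j) == W) || fl n && (q' j != [::]).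
have q'E P : count P (flatten (q' j)) = count P (flatten (q j)) +
    (if rx is Some b then (b.1 == j) * count P b.2 else 0).
  rewrite /q' /tail_in; case: (rx) => [b|]; last by rewrite addn0.
  by rewrite eq_sym; case: eqP => _; rewrite ?mul1n ?addn0 // flatten_rcons count_cat.
have [q'W q'k] : size (q' j) <= W /\ all (fun v => size v == k) (q' j).
  by apply: tail_in_ok; rewrite ?(qk j).1 ?(qk j).2.
exists (ready j * ((W - size (q' j)) * k)).
  have [rj|] := boolP (ready j); rewrite ?mul0n // mul1n.
  move: rj; rewrite /ready; case: eqP => [->|_] /=; first by rewrite subnn.
  by case: (fl n) => //= _; rewrite ?mul1n -[X in _ <= X]WkK leq_mul2r leq_subr orbT //.
move=> P; rewrite fcount_cat -!addnA; congr (_ + _); rewrite addnA -q'E.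
rewrite {1}/fcount big_map big_filter_cond big_enum_cond /=.
have [rj|nrj] := boolP (ready j).
  rewrite (big_pred1 j) /=; last first.
    by move=> j' /=; rewrite andbC; case: eqP => // ->.
  rewrite -/(ready j) rj flatten_cat count_cat addn0; congr (_ + _).
  elim: (W - _) => [|m IH] /=; first by rewrite !muln0.
  by rewrite count_cat IH count_nseq !mul1n mulSn mulnDr.
rewrite -/(ready j) (negbTE nrj) big_pred0 ?mul0n ?muln0 ?addn0 //.
by move=> j'; rewrite andbC; case: eqP => // -> /=; exact: negbTE.
Qed.

(** In each slot at most one input is about to face the first tail module, so the batches that have
    left the inputs are exactly those that have entered the tail SRAM. *)
Lemma sum_loaded P j n :
  \sum_(i < N) bcount P j (take (loaded i n.+1) (inlog i n.+1)) =
  \sum_(i < N) bcount P j (take (loaded i n) (inlog i n)) + loadcount P j n.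
Proof.
have stay (i : 'I_N) : ~~ periodic N i.+1 n ->
    take (loaded i n.+1) (inlog i n.+1) = take (loaded i n) (inlog i n).
  move=> /negbTE ni; rewrite /loaded /= ni addn0 -/(loaded i n).
  by have [s ->] := inlog_prefix i (leqnSn n); rewrite takel_cat // loaded_le.
rewrite /loadcount /load; case: pickP => [i pi|np]; last first.
  by rewrite addn0; apply: eq_bigr => i _; rewrite stay ?np.
rewrite (bigD1 i) //= [in RHS](bigD1 i) //= -addnA [X in _ = _ + X]addnC addnA; congr (_ + _); last first.
  apply: eq_bigr => i' ii'; rewrite stay //; apply: contra ii' => pi'.
  apply/eqP/val_inj/eqP; rewrite /= -eqSS.
  have h : i.+1 = i'.+1 %[mod N].
    apply/eqP; rewrite -(eqn_modDl n).
    by move: pi pi'; rewrite /periodic /dvdn => /eqP -> /eqP ->.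
  have e : i = i' %[mod N].
    by apply/eqP; rewrite -(eqn_modDl 1) !add1n; apply/eqP.
  by move: e; rewrite !modn_small // => ->.
rewrite /loaded /= pi -/(loaded i n) /=.
have [s ->] := inlog_prefix i (leqnSn n).
case: ltnP => h; last first.
  by rewrite addn0 drop_oversize //= addn0 takel_cat // loaded_le.
rewrite addn1 takel_cat //.
case e: (drop (loaded i n) (inlog i n)) => [|b l] /=.
  by have := congr1 size e; rewrite size_drop /=; lia.
have -> : take (loaded i n).+1 (inlog i n) = rcons (take (loaded i n) (inlog i n)) b.
  by rewrite -[in LHS](cat_take_drop (loaded i n) (inlog i n)) e take_cat
    size_takel ?loaded_le // ltnNge leqnSn /= subSnn /= take0 -cats1.
rewrite -cats1 bcount_cat; congr (_ + _).
by rewrite /bcount big_mkcond big_seq1; case: eqP; rewrite ?mul1n.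
Qed.

End Machine.

(** * Correctness of the pipeline *)

(** [tailq] is one slot ahead of the first tail module, so that with [s.-1] its
    frames are padded in the same slots as the batches. *)
Definition periodic_policy (R : realType) (c : config R) (M : nat) : policy c :=
  Policy (fun s _ _ _ => M %| s)%N (fun s _ _ => M %| s.-1)%N.

Section Chunks.
Local Open Scope nat_scope.
Variable T : Type.

Lemma chunk_flatten (s m : nat) (l : seq (seq T)) :
  all (fun v => size v == s) l -> m < size l ->
  take s (drop (m * s) (flatten l)) = nth [::] l m.
Proof.
elim: l m => //= v l IH m /andP[/eqP vs ls]; case: m => [|m] ml /=.
  by rewrite drop0 take_cat vs ltnn subnn take0 cats0.
by rewrite mulSn addnC -drop_drop drop_size_cat // IH.
Qed.

Lemma flatten_chunks (s n : nat) (v : seq T) :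
  flatten [seq take s (drop (i * s) v) | i <- iota 0 n] = take (n * s) v.
Proof.
elim: n => [|n IH]; first by rewrite take0.
rewrite -addn1 iotaD map_cat flatten_cat IH /= cats0 add0n mulnDl mul1n.
by rewrite takeD.
Qed.

End Chunks.

Section Refinement.
Local Open Scope nat_scope.
Variables (R : realType) (c : config R) (eps : R) (M : nat) (tr : traffic c).
Local Notation N := (cN c).
Local Notation k := (ck c).
Local Notation K := (cK c).
Local Notation W := (cK c %/ ck c).
Local Notation ks := (ck c %/ cN c).
Local Notation Ks := (cK c %/ cN c).
Local Notation G := (cL c %/ cgam c).
Local Notation new := (new_packets eps tr).
Local Notation fl := (dvdn M).
Local Notation st n := (run eps (periodic_policy c M) tr n).
Local Notation inq := (inq fl new).
Local Notation inlog := (inlog fl new).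
Local Notation loaded := (loaded fl new).
Local Notation load := (load fl new).
Local Notation tailq := (tailq fl new).
Local Notation flog := (flog fl new).
Local Notation popped := (popped fl new).
Local Notation written := (written fl new).
Local Notation hbmq := (hbmq fl new).
Local Notation reads := (reads fl new).
Local Notation delivered := (delivered fl new).
Local Notation headlog := (headlog fl new).
Local Notation started := (started fl new).

Hypothesis ok : config_ok c.
Let N0 : 0 < N := okN ok.
Let k0 : 0 < k := okk ok.
Let K0 : 0 < K := okK ok.
Let WkK : W * k = K. Proof. by rewrite divnK // okkK. Qed.
Let W0 : 0 < W. Proof. by rewrite divn_gt0 // dvdn_leq // okkK. Qed.
Let Nks : N * ks = k. Proof. by rewrite mulnC divnK // okNk. Qed.
Let WksKs : W * ks = Ks.
Proof. by rewrite -[X in _ = X %/ _]WkK -[X in _ = _ * X %/ _]Nks mulnCA mulKn. Qed.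

(** * Input ports, first crossbar and tail SRAM *)

Lemma in_portE i n : ip_q (st_in (st n) i) = (inq i n).1 /\
  ip_fifo (st_in (st n) i) = drop (loaded i n) (inlog i n).
Proof.
elim: n => [|n [IHq IHf]]; first by [].
rewrite /= /in_step /inlog /= IHq IHf.
have le := loaded_le fl new ok i n.
rewrite /loaded /= -/(loaded i n) -/(inlog i n).
have -> : periodic N i.+1 n = ((i + n.+1) %% N == 0).
  by rewrite /periodic addnC addSnnS.
case eqn: (inq i n) => [q L].
have [g [_]] := foldl_accept_cat q [::] (new n i).
move: (foldl _ (q, [::]) _).1 => q1 e.
set f := (if _ then behead _ else _).
have Lq : inlog i n = L by rewrite /inlog eqn.
have -> /= : f = drop (loaded i n + (((i + n.+1) %% N == 0) && (loaded i n < size (inlog i n)))) L.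
  rewrite /f Lq; case: eqP => _ /=; last by rewrite addn0.
  case: ltnP => h; first by rewrite addn1 -drop1 drop_drop add1n.
  by rewrite addn0 drop_oversize.
rewrite !e /flush_batches /=; split=> //.
rewrite -!catA drop_cat; case: ifP => [//|/negbT]; rewrite -leqNgt.
set d := _ + _ => Ld; rewrite drop_oversize //.
have -> : d - size L = 0; last by rewrite drop0.
apply/eqP; rewrite subn_eq0 /d -Lq; move: le.
by case: (_ == 0) => /=; rewrite ?addn0 //; case: ltnP => /= h; lia.
Qed.

(** In slot [n] input [i] faces tail module [r], so it is sending slice [r] of a batch whose slice
    [0] was sent [r] slots ago and which was loaded one slot before that. *)
Lemma ip_txE i n : ip_tx (st_in (st n) i) =
  let r := (i + n) %% N in
  if r < n then ohead (drop (loaded i (n - r.+1)) (inlog i (n - r.+1))) else None.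
Proof.
elim: n => [|n IH] /=; first by [].
rewrite /in_step; case: (flush_batches _ _) => q f /=.
rewrite IH (in_portE i n).2 addnS -addn1 -modnDml addn1.
have := ltn_pmod (i + n) N0; set r := (i + n) %% N.
rewrite leq_eqVlt => /orP[/eqP ->|rN]; first by rewrite modnn eqxx /= subn1.
by rewrite (modn_small rN) /= subSS ltnS.
Qed.

Lemma tail_rxE n (m : 'I_N) : tail_rx n (st n) m =
  if m < n then omap (fun b : batch c => (b.1, batch_slice m b)) (load (n - m.+1))
  else None.
Proof.
rewrite /tail_rx /load; have mN := ltn_ord m.
case: pickP => [i /eqP im|no]; last first.
  (* The input facing module [m] in slot [n] is [m - n] modulo [N]. *)
  exfalso; pose i : 'I_N := Ordinal (ltn_pmod (m + (N - n %% N)) N0).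
  have := no i; rewrite /= modnDml => /negP; apply.
  have -> : m + (N - n %% N) + n = (n %/ N).+1 * N + m.
    by have := divn_eq n N; have := ltn_pmod n N0; rewrite mulSn; lia.
  by rewrite modnMDl modn_small.
rewrite ip_txE /= im; case: ltnP => // mn.
case: pickP => [i' pi'|/(_ i)]; last first.
  move=> /negP[]; rewrite /periodic.
  have := divn_eq (i + n) N; rewrite im => e.
  have -> : n - m.+1 + i.+1 = i + n - m by lia.
  by rewrite e addnK dvdn_mull.
suff -> : i' = i by [].
apply/val_inj => /=; rewrite -(modn_small (ltn_ord i)) -(modn_small (ltn_ord i')).
apply/eqP; rewrite -(eqn_modDr n) im.
have -> : i' + n = n - m.+1 + i'.+1 + m by lia.
by move: pi'; rewrite /periodic => /eqP pi'; rewrite -modnDml pi' add0n modn_small.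
Qed.

Lemma st_flushE n m : m < N -> nth (fun=> false) (st_flush (st n)) m =
  if m < n then fun=> M %| (n - m.+1).-1 else fun=> false.
Proof.
elim: n m => [|n IH] m mN /=; first by rewrite nth_nil.
rewrite nth_take //; case: m mN => [|m] mN /=; first by rewrite subn1.
by rewrite IH ?subSS ?ltnS // ltnW.
Qed.

Lemma flush_signalE n m j : m < N -> m < n ->
  nth (fun=> false) (pad_frame (periodic_policy c M) n (st n) :: st_flush (st n)) m j =
  fl (n - m.+1).
Proof.
case: m => [|m] mN mn /=; first by rewrite subn1.
rewrite st_flushE; [|exact: ltnW].
by rewrite ltnW // -subnS.
Qed.

Definition slc (m : nat) (v : seq (cell c)) : seq (cell c) := take ks (drop (m * ks) v).

Lemma size_slc (m : 'I_N) v : size v = k -> size (slc m v) = ks.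
Proof.
move=> vk; rewrite /slc size_take size_drop vk -[X in X - _]Nks -mulnBl.
case: ltnP => //; have : ks <= (N - m) * ks by rewrite leq_pmull // subn_gt0.
by lia.
Qed.

Definition slframe (m : nat) (f : tframe c) : frame_slice c := (f.1, map (slc m) f.2).

(** Slicing commutes with a step of the tail SRAM: the formation of a frame depends only on the
    lengths of the queues, which slicing preserves, and a slice of a padding batch is a padding
    slice. *)
Lemma tail_stepE (m : 'I_N) x y d rx f (fg : 'I_N -> bool) (pop : bool) :
  (forall j, tm_q x j = map (slc m) (y.1 j)) ->
  tm_fifo x = map (slframe m) (drop d y.2) -> (pop -> d < size y.2) -> d <= size y.2 ->
  (forall j, fg j = f) ->
  let x' := tail_step (omap (fun b : batch c => (b.1, batch_slice m b)) rx) fg pop x in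
  let y' := tail_abs rx f y in
  (forall j, tm_q x' j = map (slc m) (y'.1 j)) /\
  tm_fifo x' = map (slframe m) (drop (d + pop) y'.2).
Proof.
move=> qE fE dpop dy fgE.
pose q j := if omap (fun b : batch c => (b.1, batch_slice m b)) rx is Some (j', sl)
            then if j == j' then rcons (tm_q x j) sl else tm_q x j else tm_q x j.
pose q' := tail_in rx y.1.
pose rd j := (size (q j) == W) || fg j && (q j != [::]).
pose rd' j := (size (q' j) == W) || f && (q' j != [::]).
have qq j : q j = map (slc m) (q' j).
  rewrite /q /q' /tail_in; case: (rx) => [b|] //=.
  by rewrite qE; case: eqP => // _; rewrite map_rcons.
have rr : rd =1 rd' by move=> j; rewrite /rd /rd' fgE qq size_map; case: (q' j).
pose new' := [seq (j, q' j ++ nseq (W - size (q' j)) (nseq k None)) | j <- enum 'I_N & rd' j].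
pose old := if pop then behead (tm_fifo x) else tm_fifo x.
split=> [j|].
  change ((if rd j then [::] else q j) = map (slc m) (if rd' j then [::] else q' j)).
  by rewrite rr qq; case: ifP.
change (old ++ [seq (j, q j ++ nseq (W - size (q j)) (nseq ks None)) | j <- enum 'I_N & rd j]
  = map (slframe m) (drop (d + pop) (y.2 ++ new'))).
have -> : old = map (slframe m) (drop (d + pop) y.2).
  rewrite /old fE; case: (pop) dpop => [/(_ isT) h|_]; last by rewrite addn0.
  by rewrite addn1 behead_map -drop1 drop_drop add1n.
have dp : d + pop <= size y.2 by case: (pop) dpop => [/(_ isT)|_]; lia.
have -> : drop (d + pop) (y.2 ++ new') = drop (d + pop) y.2 ++ new'.
  rewrite drop_cat ltn_neqAle dp andbT; case: eqP => //= ->.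
  by rewrite subnn drop0 drop_size.
rewrite map_cat; congr (_ ++ _).
rewrite (eq_filter rr) -map_comp; apply: eq_map => j /=.
rewrite /slframe /=; congr (_, _); rewrite qq map_cat size_map; congr (_ ++ _).
rewrite map_nseq; congr (nseq _ _); rewrite /slc drop_nseq take_nseq //.
by rewrite -[X in X - _]Nks -mulnBl leq_pmull // subn_gt0.
Qed.

Lemma boundaryE n : boundary c n = periodic W 0 n.
Proof. by rewrite /boundary /periodic addn0. Qed.

(** The last module has the oldest view of the log, so when it holds a frame slice all the others
    do. *)
Lemma hbm_pop_fifo n :
  (forall m : 'I_N, tm_fifo (st_tail (st n) m) =
     map (slframe m) (drop (popped n) (flog (n - m.+1)))) ->
  hbm_pop n (st n) = periodic W 0 n && (popped n < size (flog (n - N))).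
Proof.
move=> fE; rewrite /hbm_pop boundaryE; congr (_ && _).
apply/forallP/idP => [|h m'].
  have lN : N.-1 < N by lia.
  move=> /(_ (Ordinal lN)); rewrite fE /= prednK //.
  by apply: contraR; rewrite -leqNgt => h; rewrite drop_oversize.
rewrite fE -size_eq0 size_map size_drop -lt0n subn_gt0.
apply: leq_trans h _; apply: flog_size_mono.
by have := ltn_ord m'; lia.
Qed.

(** Arrivals reach module [m] with a delay of [m.+1] slots, but a frame is removed from all modules
    at the same time; hence [popped] is taken at [n] and the log at [n - m.+1]. Whether a frame is
    removed depends on every module, so the induction treats all modules together. *)
Lemma tail_moduleE n (m : 'I_N) :
  (forall j, tm_q (st_tail (st n) m) j = map (slc m) ((tailq (n - m.+1)).1 j)) /\
  tm_fifo (st_tail (st n) m) = map (slframe m) (drop (popped n) (flog (n - m.+1))).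
Proof.
elim: n m => [|n IH] m; first by [].
have pp := hbm_pop_fifo (fun m => (IH m).2).
have ps : popped n.+1 = popped n + hbm_pop n (st n) by rewrite pp.
have mN := ltn_ord m.
have sub : size (flog (n - N)) <= size (flog (n - m.+1)).
  by apply: flog_size_mono; lia.
have pl := popped_le_sub fl new ok n.
rewrite ps /= subSS; have [mn|nm] := ltnP m n.
  rewrite -(subnSK mn) /= tail_rxE mn.
  have := @tail_stepE m (st_tail (st n) m) (tailq (n - m.+1)) (popped n)
     (load (n - m.+1)) (fl (n - m.+1)).
  apply; [exact: (IH m).1|exact: (IH m).2| | |].
  - by rewrite pp => /andP[_ h]; apply: leq_trans h sub.
  - exact: leq_trans pl sub.
  - by move=> j; apply: flush_signalE.
have e0 : n - m.+1 = 0 by lia.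
have e1 : n - m = 0 by lia.
have [Iq If] := IH m; rewrite tail_rxE ltnNge nm /= e1 /=.
move: sub; rewrite pp e0 leqn0 => /eqP -> /=; rewrite ltn0 andbF /=.
move: Iq If; rewrite e0 /= => Iq If.
(* No batch has reached module [m] yet. The padding decision of slot [0] may arrive already, but it
   finds only empty queues. *)
have nr j : (size (tm_q (st_tail (st n) m) j) == W)
    || nth (fun=> false) ((fun=> M %| n.-1) :: st_flush (st n)) m j &&
       (tm_q (st_tail (st n) m) j != [::]) = false.
  by rewrite Iq /= andbF orbF eq_sym; apply/negbTE; rewrite -lt0n.
split=> [j|]; first by rewrite nr Iq.
by rewrite If (eq_filter nr) filter_pred0.
Qed.

Lemma hbm_popE n : hbm_pop n (st n) = periodic W 0 n && (popped n < size (flog (n - N))).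
Proof. exact: hbm_pop_fifo (fun m => (tail_moduleE n m).2). Qed.

(** * Storage of frames in the HBM *)

Definition layout (bs : seq (seq (cell c))) : seq (cell c) :=
  flatten [seq flatten [seq slc m v | v <- bs] | m : 'I_N <- enum 'I_N].

Definition layframe (f : tframe c) : frame c := (f.1, layout f.2).

Definition batches_ok (bs : seq (seq (cell c))) : bool :=
  (size bs == W) && all (fun v => size v == k) bs.

Lemma size_flatten_all T (s : nat) (l : seq (seq T)) :
  all (fun v => size v == s) l -> size (flatten l) = size l * s.
Proof.
elim: l => //= v l IH /andP[/eqP vs /IH ls].
by rewrite size_cat vs ls mulSn.
Qed.

Lemma size_slices (m : 'I_N) bs : batches_ok bs ->
  size (flatten [seq slc m v | v <- bs]) = Ks.
Proof.
case/andP=> /eqP sb /allP kb; rewrite (@size_flatten_all _ ks) ?size_map ?sb ?WksKs //.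
by rewrite all_map; apply/allP => v /kb /eqP vk /=; rewrite size_slc.
Qed.

Lemma size_layout bs : batches_ok bs -> size (layout bs) = K.
Proof.
move=> kb; rewrite /layout (@size_flatten_all _ Ks); last first.
  by rewrite all_map; apply/allP => m _ /=; rewrite size_slices.
by rewrite size_map size_enum_ord -WksKs mulnCA Nks.
Qed.

(** A frame in the HBM lists its bytes module by module, not batch by batch, because each tail
    module contributes one contiguous frame slice. Cutting it into [N] equal parts thus gives head
    module [m] the slices that tail module [m] held. *)
Lemma frame_slicesE (m : 'I_N) j bs : batches_ok bs ->
  frame_slices m (j, layout bs) = map (slc m) bs.
Proof.
move=> kb; rewrite /frame_slices /= chunk_flatten; last 2 first.
- by rewrite all_map; apply/allP => m' _ /=; rewrite size_slices.
- by rewrite size_map size_enum_ord.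
rewrite (nth_map m) ?size_enum_ord // nth_ord_enum.
case/andP: kb => /eqP sb /allP kb.
suff -> : nseq W ks = shape (map (slc m) bs) by rewrite flattenK.
rewrite /shape -map_comp -sb.
by elim: (bs) kb => //= v l IH kb; rewrite size_slc ?IH // => [u ul|];
  [apply/kb; rewrite inE ul orbT|apply/eqP/kb; rewrite mem_head].
Qed.

Lemma flog_batches_ok n f : f \in flog n -> batches_ok f.2.
Proof. by move=> fn; have [_ /allP /(_ f fn)] := tailq_ok fl new ok n. Qed.

Lemma hbmq_batches_ok j n bs : bs \in hbmq j n -> batches_ok bs.
Proof.
case/mapP => f; rewrite mem_filter => /andP[_ /mem_take fn] ->.
exact: flog_batches_ok fn.
Qed.

(** The modules see logs of different ages, but these are prefixes of one another, so the front
    slices of all modules belong to the same frame. *)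
Lemma popped_lt_nth n m d : popped n < size (flog (n - N)) -> m <= N ->
  nth d (flog (n - m)) (popped n) = nth d (flog n) (popped n).
Proof.
move=> h mN; have [s ->] := flog_prefix fl new (leq_subr m n).
rewrite nth_cat; case: ltnP => //; rewrite leqNgt => /negP[].
by apply: leq_trans h _; apply: flog_size_mono; lia.
Qed.

Lemma head_frameE n d : popped n < size (flog (n - N)) ->
  head_frame (st n) = Some (layframe (nth d (flog n) (popped n))).
Proof.
move=> h; set f := nth d (flog n) (popped n).
have e (m : 'I_N) : ohead (tm_fifo (st_tail (st n) m)) = Some (slframe m f).
  rewrite (tail_moduleE _ _).2.
  have mN := ltn_ord m.
  rewrite (drop_nth d).
    by rewrite /= (popped_lt_nth d h).
  by apply: leq_trans h _; apply: flog_size_mono; lia.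
rewrite /head_frame.
have -> : pmap (fun m => ohead (tm_fifo (st_tail (st n) m))) (enum 'I_N) =
    [seq slframe m f | m : 'I_N <- enum 'I_N].
  by elim: (enum 'I_N) => //= m l IH; rewrite e /= IH.
have [m [l en]] : exists m l, enum 'I_N = m :: l.
  case el: (enum 'I_N) => [|m l]; last by exists m, l.
  by have := size_enum_ord N; rewrite el /=; lia.
have -> : ohead [seq slframe m0 f | m0 : 'I_N <- enum 'I_N] = Some (slframe m f).
  by rewrite en.
by rewrite /= -map_comp.
Qed.

Let gam0 : 0 < cgam c.
Proof. by move: K0; rewrite (okKS ok) !muln_gt0 => /andP[/andP[]]. Qed.
Let G0 : 0 < G.
Proof. by rewrite divn_gt0 // dvdn_leq ?(okL ok) ?(okgL ok). Qed.

Definition bank_pos (b : 'I_(cL c)) (ch : 'I_(cT c)) := (b %% cgam c) * cT c + ch.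

Lemma write_frameE n fr mem (ch : 'I_(cT c)) (b : 'I_(cL c)) (j : 'I_N) r :
  write_frame n fr mem ch b j r =
  if [&& b \in group_banks c n, j == fr.1 & r == n %/ G]
  then take (cS c) (drop (bank_pos b ch * cS c) fr.2) else mem ch b j r.
Proof.
rewrite /write_frame; elim: (group_banks c n) mem => //= b' l IH mem.
rewrite IH inE /write_bank; have [->|bb'] := eqVneq b b'; last by [].
by rewrite /=; case: (_ \in l) => /=; case: (_ && _).
Qed.

Lemma group_banksE n : [seq nat_of_ord b | b <- group_banks c n] =
  iota (cgam c * (n %% G)) (cgam c).
Proof.
rewrite /group_banks.
have -> : [seq nat_of_ord b | b : 'I_(cL c) <- enum 'I_(cL c)
    & b %/ cgam c == n %% G] = [seq x <- iota 0 (cL c) | x %/ cgam c == n %% G].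
  by rewrite -val_enum_ord filter_map.
have LG : cL c = G * cgam c by rewrite divnK // okgL.
have nG := ltn_pmod n G0.
apply: (@irr_sorted_eq _ ltn ltn_trans ltnn).
- exact/sorted_filter/iota_ltn_sorted/ltn_trans.
- exact: iota_ltn_sorted.
move=> x; rewrite mem_filter !mem_iota add0n leq0n /=.
apply/andP/andP => [[/eqP xe xL]|[h1 h2]].
  have := divn_eq x (cgam c); have := ltn_pmod x gam0; rewrite xe (mulnC (n %% G)); lia.
have e : x %/ cgam c = n %% G.
  have xg : x - cgam c * (n %% G) < cgam c by rewrite ltn_subLR.
  by rewrite -(subnKC h1) {1}mulnC divnMDl // (divn_small xg) addn0.
rewrite e eqxx; split=> //; rewrite LG.
have : (n %% G).+1 * cgam c <= G * cgam c by rewrite leq_mul2r nG orbT.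
by rewrite mulSn (mulnC (n %% G)); lia.
Qed.

Lemma read_written (mem : 'I_(cT c) -> 'I_(cL c) -> 'I_N -> nat -> seq (cell c))
    n (fr : frame c) : size fr.2 = K ->
  read_frame (write_frame n fr mem) fr.1 n = fr.
Proof.
case: fr => j v /= vK; rewrite /read_frame; congr (_, _).
have -> : [seq write_frame n (j, v) mem ch b j (n %/ G)
     | b <- group_banks c n, ch <- enum 'I_(cT c)] =
   flatten [seq [seq take (cS c) (drop ((x * cT c + y) * cS c) v)
     | y <- iota 0 (cT c)] | x <- iota 0 (cgam c)].
  have -> : iota 0 (cgam c) = [seq b %% cgam c | b : 'I_(cL c) <- group_banks c n].
    rewrite [RHS](map_comp (fun x => x %% cgam c) (@nat_of_ord _)) group_banksE.
    rewrite -[in RHS](addn0 (cgam c * _)) iotaDl -map_comp -[LHS]map_id.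
    apply/eq_in_map => x; rewrite mem_iota add0n => /andP[_ xg] /=.
    by rewrite mulnC modnMDl modn_small.
  rewrite -map_comp; congr flatten; apply/eq_in_map => b bn /=.
  rewrite -val_enum_ord -map_comp; apply: eq_map => ch /=.
  by rewrite write_frameE bn !eqxx.
transitivity (take (cgam c * (cT c * cS c)) v); last first.
  by rewrite take_oversize // vK (okKS ok) mulnA.
have ff (f : nat -> nat -> seq (cell c)) s t :
    flatten [seq f x y | x <- s, y <- t] = flatten [seq flatten [seq f x y | y <- t] | x <- s].
  by elim: s => //= x s IH; rewrite flatten_cat IH.
rewrite ff -flatten_chunks; congr flatten; apply: eq_map => x.
rewrite -flatten_chunks; congr flatten; apply: eq_map => y.
by rewrite drop_drop mulnDl mulnA addnC.
Qed.

(** A frame number is determined by its group [n %% G] and its row [n %/ G], so different frames of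
    one output share no segment, and different outputs have separate regions. *)
Lemma read_unwritten (mem : 'I_(cT c) -> 'I_(cL c) -> 'I_N -> nat -> seq (cell c))
    n (fr : frame c) j r : (j != fr.1) || (r != n) ->
  read_frame (write_frame n fr mem) j r = read_frame mem j r.
Proof.
move=> jr; rewrite /read_frame; congr (_, flatten _); congr flatten.
apply/eq_in_map => b br; apply: eq_map => ch; rewrite write_frameE.
case: ifP => // /and3P[bn /eqP jj /eqP rn]; move: jr; rewrite jj eqxx /= => /eqP[].
move: br bn; rewrite !mem_filter => /andP[/eqP br _] /andP[/eqP bn _].
by rewrite (divn_eq r G) (divn_eq n G) rn -br -bn.
Qed.

Let d0 : tframe c := (Ordinal N0, [::]).

(** At most one frame leaves the tail SRAM per boundary, and the next boundary counts it as
    written. *)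
Lemma popped_le_writtenS n : popped n <= (written n).+1.
Proof.
elim: n => // n IH; rewrite /popped /written /= -/(popped n) -/(written n).
by case: (periodic _ _ _) => /=; rewrite ?addn0 //; case: (_ < _); lia.
Qed.

Lemma hbmqS j n : hbmq j n.+1 = hbmq j n ++
  (if periodic W 0 n && (written n < popped n)
   then frames_of j [:: nth d0 (flog n) (written n)] else [::]).
Proof.
rewrite /hbmq /written /= -/(written n).
have wn := written_le fl new ok n; have pn := popped_le fl new ok n.
have [s ->] := flog_prefix fl new (leqnSn n).
case: (periodic _ _ _) => /=; last by rewrite takel_cat ?cats0.
rewrite -/(popped n) takel_cat //.
have := written_le_popped fl new n; rewrite leq_eqVlt => /orP[/eqP <-|wp].
  by rewrite ltnn cats0.
have -> : popped n = (written n).+1.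
  by apply/eqP; rewrite eqn_leq popped_le_writtenS.
rewrite ltnSn (take_nth d0); last by apply: leq_trans wp pn.
by rewrite -cats1 /frames_of filter_cat map_cat.
Qed.

Lemma turnE (j : 'I_N) n :
  periodic (N * W) ((N - j) * W) n = periodic W 0 n && ((n %/ W) %% N == j).
Proof.
rewrite /periodic addn0; have [Wn|nWn] := boolP (W %| n); last first.
  apply: contraNF nWn => h; rewrite -(dvdn_addl n (dvdn_mull (N - j) (dvdnn W))).
  exact: dvdn_trans (dvdn_mull N (dvdnn W)) h.
rewrite -{1}(divnK Wn) -mulnDl dvdn_pmul2r //= /dvdn -{1}[0](mod0n N).
rewrite -(eqn_modDr j) add0n -addnA subnK ?modnDr ?(modn_small (ltn_ord j)) //.
exact: ltnW.
Qed.

(** The frames in transit account for the gaps between the counters: [hb_w] holds the frame counted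
    by [popped] but not by [written], and [hb_r] the one counted by [reads] but not by [delivered].
    The contents of the memory are specified only for the frames already written. *)
Record hbm_inv n : Prop := HbmInv {
  hbm_wE : hb_w (st_hbm (st n)) = if written n < popped n
    then Some (layframe (nth d0 (flog n) (written n))) else None;
  hbm_nwE : forall j, hb_nw (st_hbm (st n)) j = size (hbmq j n);
  hbm_memE : forall j r, r < size (hbmq j n) ->
    read_frame (hb_mem (st_hbm (st n))) j r = (j, layout (nth [::] (hbmq j n) r));
  hbm_nrE : forall j, hb_nr (st_hbm (st n)) j = reads j n;
  hbm_rE : forall j, reads j n =
    delivered j n + (if hb_r (st_hbm (st n)) is Some fr then fr.1 == j else false);
  hbm_frE : forall fr, hb_r (st_hbm (st n)) = Some fr ->
    fr.2 = layout (nth [::] (hbmq fr.1 n) (delivered fr.1 n))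
}.

Lemma hbmqP n : hbm_inv n.
Proof.
elim: n => [|n [wE nwE memE nrE rE frE]]; first by split.
have nb : ~~ periodic W 0 n -> forall j, [/\ hbmq j n.+1 = hbmq j n,
    written n.+1 = written n, popped n.+1 = popped n, reads j n.+1 = reads j n &
    delivered j n.+1 = delivered j n].
  move=> /negbTE b j; rewrite hbmqS b cats0.
  rewrite /written /popped /reads /delivered /= turnE b /= !addn0.
  by split.
rewrite /= in nb *; case: (boolP (periodic W 0 n)) => [bn|nbn]; last first.
  have {nb} e := nb nbn.
  have hs : hbm_step n (st n) = st_hbm (st n).
    by rewrite /hbm_step boundaryE nbn.
  split; rewrite /= hs.
  - have [_ -> -> _ _] := e (Ordinal N0); rewrite wE; case: ifP => // wp.
    have [s ->] := flog_prefix fl new (leqnSn n); rewrite nth_cat.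
    by rewrite (leq_trans wp (popped_le fl new ok n)).
  - by move=> j; have [-> _ _ _ _] := e j.
  - by move=> j r; have [-> _ _ _ _] := e j; exact: memE.
  - by move=> j; have [_ _ _ -> _] := e j.
  - by move=> j; have [_ _ _ -> ->] := e j.
  - by move=> fr; have [-> _ _ _ ->] := e fr.1; exact: frE.
have hS j : hbmq j n.+1 = hbmq j n ++
  (if written n < popped n
   then frames_of j [:: nth d0 (flog n) (written n)] else [::]).
  by rewrite hbmqS bn.
have wS : written n.+1 = popped n by rewrite /written /= bn.
have dS j : delivered j n.+1 = reads j n by rewrite /delivered /= bn.
have pS : popped n.+1 = popped n + (popped n < size (flog (n - N))).
  by rewrite /popped /= bn.
have rS j : reads j n.+1 = reads j n + (((n %/ W) %% N == j) && (reads j n < size (hbmq j n))).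
  by rewrite /reads /= turnE bn.
pose turn := [pick j : 'I_N | ((n %/ W) %% N == j) &&
   (hb_nr (st_hbm (st n)) j < hb_nw (st_hbm (st n)) j)].
have tE j : (turn == Some j) = ((n %/ W) %% N == j) && (reads j n < size (hbmq j n)).
  rewrite /turn; case: pickP => [j' /andP[/eqP j'E h]|h].
    apply/eqP/andP => [[<-]|[/eqP jE _]]; first by rewrite j'E -nrE -nwE.
    by congr Some; apply/val_inj; rewrite /= -jE -j'E.
  by rewrite -nrE -nwE h.
split; rewrite /= /hbm_step boundaryE bn /= -/turn.
- rewrite hbm_popE bn /= wS pS; case: ltnP => h; last by rewrite addn0 ltnn.
  rewrite addn1 ltnSn (head_frameE d0 h).
  have [s ->] := flog_prefix fl new (leqnSn n); rewrite nth_cat.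
  rewrite (leq_trans h) //; exact/flog_size_mono/leq_subr.
- move=> j; rewrite nwE wE hS size_cat; congr (_ + _).
  by case: ifP => //= _; rewrite /frames_of /=; case: eqP.
- move=> j r; rewrite hS wE; case: ifP => wp; last by rewrite cats0; exact: memE.
  set f := nth d0 _ _; rewrite size_cat nwE.
  have fK : size (layframe f).2 = K.
    apply: size_layout; apply: (@flog_batches_ok n); apply: mem_nth.
    exact: leq_trans wp (popped_le fl new ok n).
  move=> rj; have [rl|lr] := ltnP r (size (hbmq j n)).
    rewrite read_unwritten ?memE ?nth_cat ?rl //.
    have [ej|//] := eqVneq j (layframe f).1.
    by move: rl; rewrite ej; case: ltngtP.
  move: rj; rewrite /frames_of /=; case: eqP => [ej|_]; last by rewrite addn0 ltnNge lr.
  rewrite addn1 ltnS => rl.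
  have -> : r = size (hbmq j n) by apply/eqP; rewrite eqn_leq rl.
  by rewrite -ej nth_cat ltnn subnn (read_written _ _ fK).
- by move=> j; rewrite nrE rS tE.
- move=> j; rewrite rS dS -tE; congr (_ + _).
  by case: (turn).
- move=> fr; case et: turn => [j|] // [<-].
  have := tE j; rewrite et eqxx => /esym/andP[_ rj].
  by rewrite nrE memE //= -/(hbmq j n.+1) -/(delivered j n.+1) dS hS nth_cat rj.
Qed.

(** * Head SRAM and second crossbar *)

Lemma headlogS j n : headlog j n.+1 = headlog j n ++
  (if periodic W 0 n then
     if hb_r (st_hbm (st n)) is Some fr then
       if fr.1 == j then nth [::] (hbmq j n) (delivered j n) else [::]
     else [::]
   else [::]).
Proof.
have rE := hbm_rE (hbmqP n) j.
have rl := reads_le fl new ok j n; have dl := delivered_le fl new ok j n.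
rewrite /headlog /delivered /= -/(delivered j n) -/(reads j n).
have [s hs] := hbmq_prefix fl new ok j (leqnSn n).
rewrite -/(hbmq j n.+1) hs; case: (periodic _ _ _) => /=; last by rewrite takel_cat // cats0.
rewrite takel_cat // rE; move: rE.
case: (hb_r _) => [fr|]; last by rewrite addn0 cats0.
case: eqP => _; last by rewrite addn0 cats0.
rewrite addn1 => rE; rewrite (take_nth [::]); last by rewrite -rE.
by rewrite flatten_rcons.
Qed.

Lemma headlog_size_ok j n v : v \in headlog j n -> size v = k.
Proof.
case/flattenP => bs /mem_take /hbmq_batches_ok /andP[_ /allP h] /h.
by move/eqP.
Qed.

Lemma head_stepE n (m j : 'I_N) d :
  st_head (st n) m j = map (slc m) (drop d (headlog j n)) ->
  d + (sending n (st n) j == Some m) <= size (headlog j n) ->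
  st_head (st n.+1) m j =
    map (slc m) (drop (d + (sending n (st n) j == Some m)) (headlog j n.+1)).
Proof.
move=> hE dl; rewrite /= /head_step hE boundaryE headlogS.
set b := sending _ _ _ == _ in dl *.
rewrite drop_cat; set d' := d + b in dl *.
have -> : (if b then behead [seq slc m i | i <- drop d (headlog j n)]
    else [seq slc m i | i <- drop d (headlog j n)]) =
    [seq slc m i | i <- drop d' (headlog j n)].
  rewrite /d'; case: (b); last by rewrite addn0.
  by rewrite behead_map addn1 -drop1 drop_drop add1n.
set add := (X in _ ++ X = _); set new' := (X in _ = map _ (if _ then _ ++ X else _)).
suff -> : add = map (slc m) new'.
  case: ltnP => h; first by rewrite map_cat.
  have -> : d' = size (headlog j n) by apply/eqP; rewrite eqn_leq dl.
  by rewrite subnn drop_size drop0.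
rewrite /add /new'; case: (periodic _ _ _) => //.
have rE := hbm_rE (hbmqP n) j; have := @hbm_frE n (hbmqP n).
case er: (hb_r _) rE => [fr|] // rE /(_ fr erefl) frE; case: eqP => // frj.
have dh : delivered j n < size (hbmq j n).
  by have := reads_le fl new ok j n; rewrite rE frj eqxx addn1.
have -> : fr = (j, layout (nth [::] (hbmq j n) (delivered j n))).
  by rewrite -frj -frE; case: (fr).
by rewrite frame_slicesE //; apply: (@hbmq_batches_ok j n); rewrite mem_nth.
Qed.

(** The head module that faces output [j] in slot [n]. *)
Definition phase (j : 'I_N) (n : nat) : nat := (j + n) %% N.

Definition completed (j : 'I_N) (n : nat) : nat :=
  started j n - op_on (st_out (st n) j).

(** While a batch crosses, the modules before [phase] have given up their slices of it and those
    from [phase] on still hold theirs; this is the correction by one in [out_headE]. *)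
Record out_inv j n : Prop := OutInv {
  out_onE : op_on (st_out (st n) j) -> 0 < phase j n /\ 0 < started j n;
  out_rxE : op_rx (st_out (st n) j) = if op_on (st_out (st n) j)
    then take (phase j n * ks) (nth [::] (headlog j n) (started j n).-1) else [::];
  out_headE : forall m : 'I_N, st_head (st n) m j = map (slc m)
    (drop (started j n - (op_on (st_out (st n) j) && (phase j n <= m))) (headlog j n))
}.

Definition port_data (x : out_port c) := (op_buf x, op_free x, op_sent x).

Lemma phaseS j n : phase j n.+1 = if (phase j n).+1 == N then 0 else (phase j n).+1.
Proof.
rewrite /phase addnS -addn1 -modnDml addn1; have := ltn_pmod (j + n) N0.
rewrite leq_eqVlt; case: eqP => [->|_] /=; first by rewrite modnn.
by move=> h; rewrite modn_small.
Qed.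

Definition sends j n :=
  if phase j n == 0 then started j n < size (headlog j n) else op_on (st_out (st n) j).

Lemma sendingE j n (m : 'I_N) : out_inv j n ->
  (sending n (st n) j == Some m) = sends j n && (phase j n == m).
Proof.
move=> [onE rxE headE].
have test (m' : 'I_N) : ((j + n) %% N == m') && (if m' == 0 :> nat
     then st_head (st n) m' j != [::] else op_on (st_out (st n) j)) =
    sends j n && (phase j n == m').
  rewrite andbC -/(phase j n); have [e|] := eqVneq (phase j n) m'; last by rewrite !andbF.
  rewrite !andbT /sends e; case: eqP => // m0.
  have /negbTE onF : ~~ op_on (st_out (st n) j).
    by apply/negP => /onE[]; rewrite e m0.
  by rewrite headE onF subn0 -size_eq0 size_map size_drop subn_eq0 -ltnNge.
rewrite /sending; case: pickP => [m'|no].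
  rewrite test => /andP[-> /eqP pm] /=.
  apply/eqP/eqP => [[<-]|pm'] //; congr Some; apply: val_inj; by rewrite /= -pm -pm'.
by rewrite -test no.
Qed.

Lemma receive_frame t (x : out_port c) u :
  op_on (foldl (receive t) x u) = op_on x /\ op_rx (foldl (receive t) x u) = op_rx x.
Proof.
elim: u x => //= v u IH x; have [-> ->] := IH (receive t x v).
by rewrite /receive; case: v => // pb; case: ifP.
Qed.

Lemma receive_data t (x y : out_port c) u : port_data x = port_data y ->
  port_data (foldl (receive t) x u) = port_data (foldl (receive t) y u).
Proof.
elim: u x y => //= v u IH x y e; apply: IH; move: e; rewrite /port_data /receive.
case: x => ? ? b f s; case: y => ? ? b' f' s' /= [-> -> ->].
by case: v => // pb; case: ifP.
Qed.

Definition slot_end (n : nat) : R := (n.+1%:R * slot_time c eps)%R.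

(** The packet data of a port change only in the slot that brings the last slice of a batch, and
    then by the whole batch at once. This allows the rest of the proof to follow batches instead of
    slices. *)
Definition out_next j n : Prop :=
  if sends j n && ((phase j n).+1 == N) then
    [/\ completed j n < size (headlog j n), completed j n.+1 = (completed j n).+1 &
     port_data (st_out (st n.+1) j) = port_data (foldl (receive (slot_end n))
       (st_out (st n) j) (nth [::] (headlog j n) (completed j n)))]
  else completed j n.+1 = completed j n /\
     port_data (st_out (st n.+1) j) = port_data (st_out (st n) j).

Lemma started_step j n : started j n.+1 =
  started j n + ((phase j n == 0) && (started j n < size (headlog j n))).
Proof. by rewrite /started /= /periodic /phase (addnC j n). Qed.

Lemma out_step_sending j n : out_inv j n -> st_out (st n.+1) j =
  if sends j n then
    let rx := op_rx (st_out (st n) j) ++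
              slc (phase j n) (nth [::] (headlog j n) (started j n.+1).-1) in
    let x := st_out (st n) j in
    if (phase j n).+1 == N then foldl (receive (slot_end n))
        (OutPort false [::] (op_buf x) (op_free x) (op_sent x)) rx
    else OutPort true rx (op_buf x) (op_free x) (op_sent x)
  else st_out (st n) j.
Proof.
move=> inv; rewrite [LHS]/= /out_step.
case es: (sending _ _ _) => [m|]; last first.
  have pN : phase j n < N by rewrite ltn_mod.
  by have := sendingE (Ordinal pN) inv; rewrite es /= eqxx andbT => <-.
have := sendingE m inv; rewrite es eqxx => /esym/andP[sd /eqP pm].
rewrite sd pm; set v := head _ _; set w := slc _ _.
suff -> : v = w by [].
rewrite /v /w (out_headE inv) pm leqnn andbT started_step.
have [hd_ e] : started j n - op_on (st_out (st n) j) < size (headlog j n) /\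
   (started j n + ((phase j n == 0) && (started j n < size (headlog j n)))).-1 =
   started j n - op_on (st_out (st n) j).
  have sl := started_le fl new ok j n.
  move: sd; rewrite /sends; case: eqP => [p0 lt|_ on] /=.
    have /negbTE -> : ~~ op_on (st_out (st n) j).
      by apply/negP => /(out_onE inv)[]; rewrite p0.
    by rewrite lt subn0 addn1.
  by rewrite on addn0 subn1; have [_ s0] := out_onE inv on; split=> //; lia.
by rewrite e (drop_nth [::] hd_).
Qed.

Lemma out_step_inv j n : out_inv j n -> out_inv j n.+1 /\ out_next j n.
Proof.
move=> inv; have oE := out_step_sending inv.
have pN : phase j n < N by rewrite ltn_mod.
have sl := started_le fl new ok j n.
have onE := out_onE inv.
have hp (i : nat) : i < size (headlog j n) ->
    nth [::] (headlog j n.+1) i = nth [::] (headlog j n) i.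
  move=> il; have [s ->] := headlog_prefix fl new ok j (leqnSn n).
  by rewrite nth_cat il.
have headS (m : 'I_N) : st_head (st n.+1) m j = map (slc m)
    (drop (started j n - (op_on (st_out (st n) j) && (phase j n <= m)) +
           (sends j n && (phase j n == m))) (headlog j n.+1)).
  rewrite -(sendingE m inv); apply: head_stepE; first exact: out_headE inv m.
  rewrite (sendingE m inv); move: onE; rewrite /sends.
  case: (op_on _) => [/(_ isT)[p0 s0]|_] /=.
    by rewrite gtn_eqF //=; case: ltngtP => /=; lia.
  rewrite subn0; case: (_ == 0) => /=; last by rewrite addn0.
  by case: ltnP => /= h; [case: (phase j n == m :> nat) => /=|]; lia.
have sS := started_step j n.
have size_b : started j n.+1 <= size (headlog j n).
  by rewrite sS; case: (_ == 0) => /=; [case: ltnP|]; lia.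
have [sd|nsd] := boolP (sends j n); last first.
  have e : st_out (st n.+1) j = st_out (st n) j by rewrite oE (negbTE nsd).
  have sS' : started j n.+1 = started j n.
    by move: nsd; rewrite sS /sends; case: (_ == 0) => /= [/negbTE ->|_]; rewrite addn0.
  have onF : op_on (st_out (st n) j) = false.
    by move: nsd onE; rewrite /sends; case: eqP => [-> _|_ /negbTE //];
      case: (op_on _) => // /(_ isT)[].
  split; last by rewrite /out_next (negbTE nsd) /completed sS' e.
  split; rewrite ?e ?sS' ?onF //.
    by rewrite (out_rxE inv) onF.
  by move=> m; rewrite headS onF (negbTE nsd) addn0.
set b := nth [::] (headlog j n) (started j n.+1).-1.
have s1 : 0 < started j n.+1.
  move: sd; rewrite sS /sends; case: eqP => [_ ->|_ /onE[_]]; first by rewrite addn1.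
  by rewrite addn0.
have cE : completed j n = (started j n.+1).-1.
  rewrite /completed sS; move: sd; rewrite /sends; case: eqP => [p0 ->|_ on] /=.
    have /negbTE -> : ~~ op_on (st_out (st n) j) by apply/negP => /onE[]; rewrite p0.
    by rewrite subn0 addn1.
  by rewrite on addn0 subn1.
have bk : size b = k.
  by apply: (@headlog_size_ok j n); rewrite mem_nth // prednK.
have rxE : op_rx (st_out (st n) j) ++ slc (phase j n) b = take ((phase j n).+1 * ks) b.
  rewrite (out_rxE inv) /b sS; move: sd; rewrite /sends.
  case: eqP => [p0 lt|_ on].
    have /negbTE -> : ~~ op_on (st_out (st n) j) by apply/negP => /onE[]; rewrite p0.
    by rewrite lt p0 /= mul1n /slc mul0n drop0.
  by rewrite on /= addn0 mulSn addnC takeD.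
move: oE; rewrite sd -/b rxE; case: eqP => [pN1|/eqP pN1] oE.
  have bE : take ((phase j n).+1 * ks) b = b by rewrite pN1 Nks -bk take_size.
  have onF : op_on (st_out (st n.+1) j) = false.
    by rewrite oE (receive_frame _ _ _).1.
  split; last first.
    rewrite /out_next; have -> : sends j n && ((phase j n).+1 == N) by rewrite sd pN1 eqxx.
    split.
    - by rewrite cE prednK.
    - by rewrite cE prednK // /completed onF subn0.
    by rewrite oE bE cE; apply: receive_data.
  split; rewrite ?onF //.
    by rewrite oE (receive_frame _ _ _).2.
  move=> m; rewrite headS sd /= subn0; congr (map _ (drop _ _)).
  move: cE; rewrite /completed; have mN := ltn_ord m; have : m <= phase j n by lia.
  rewrite leq_eqVlt => /orP[/eqP ->|mp]; first by rewrite leqnn eqxx andbT; lia.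
  rewrite (leqNgt _ m) mp andbF subn0 gtn_eqF // addn0 => _.
  by rewrite sS gtn_eqF ?addn0 //; lia.
have onT : op_on (st_out (st n.+1) j) = true by rewrite oE.
have pS : phase j n.+1 = (phase j n).+1 by rewrite phaseS (negbTE pN1).
split; last first.
  rewrite /out_next (negbTE pN1) andbF oE; split=> //.
  by rewrite cE /completed onT subn1.
split; rewrite ?onT ?pS //.
  by rewrite oE hp ?prednK.
move=> m; rewrite headS sd /=; congr (map _ (drop _ _)).
move: cE; rewrite /completed; case: (ltngtP (phase j n) m) => [pm|mp|pm] /=.
- by rewrite andbT addn0 => ->; rewrite subn1.
- by rewrite andbF subn0 addn0 subn0 sS gtn_eqF ?addn0 //; lia.
- by rewrite ?andbT ?subn0; lia.
Qed.

Lemma outP j n : out_inv j n.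
Proof.
elim: n => [|n IH]; last exact: (out_step_inv IH).1.
by split.
Qed.

Lemma out_nextP j n : out_next j n.
Proof. exact: (out_step_inv (outP j n)).2. Qed.

(** * Reassembly of packets and busy periods of the output line *)

Definition port_ok (r : seq (packet N * nat)) (x : out_port c) : Prop :=
  [/\ op_buf x = [seq v <- r | v.1 \notin unzip1 (op_sent x)],
      forall p, (p \in unzip1 (op_sent x)) =
        (0 < len p) && all (fun b => (p, b) \in r) (iota 0 (len p))
    & uniq (unzip1 (op_sent x))].

(** If bytes could come twice, a packet that was sent and removed from the buffer could be completed
    again. For the bytes that actually arrive this follows from conservation of bytes, see
    [received_ok]. *)
Definition cells_ok (r : seq (packet N * nat)) : Prop :=
  uniq r /\ forall v, v \in r -> v.2 < len v.1.

Lemma port_ok_data r (x y : out_port c) : port_data x = port_data y ->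
  port_ok r x -> port_ok r y.
Proof. by rewrite /port_ok => -[-> _ ->]. Qed.

Lemma receive_ok t r x pb : cells_ok (rcons r pb) -> port_ok r x ->
  port_ok (rcons r pb) (receive t x (Some pb)).
Proof.
case: pb => p b [ur vr] [bufE sentE usent]; rewrite /receive /=.
have pb_r : (p, b) \notin r by move: ur; rewrite rcons_uniq => /andP[].
have bp : b < len p by apply: (vr (p, b)); rewrite mem_rcons mem_head.
(* Byte [b] was missing until now, so [p] was incomplete. *)
have pns : p \notin unzip1 (op_sent x).
  rewrite sentE; apply/negP => /andP[_ /allP h]; move/negP: pb_r; apply.
  by apply: h; rewrite mem_iota.
have in_buf : all (fun b0 => (p, b0) \in rcons (op_buf x) (p, b)) (iota 0 (len p)) =
    all (fun b0 => (p, b0) \in rcons r (p, b)) (iota 0 (len p)).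
  by apply: eq_all => b0; rewrite !mem_rcons !inE bufE mem_filter /= pns.
have other q : q != p -> all (fun b0 => (q, b0) \in rcons r (p, b)) (iota 0 (len q)) =
    all (fun b0 => (q, b0) \in r) (iota 0 (len q)).
  by move=> /negbTE qp; apply: eq_all => b0; rewrite mem_rcons inE xpair_eqE qp.
rewrite in_buf; case: ifP => full; split=> /=.
- rewrite /unzip1 map_rcons -/(unzip1 _) /= !filter_rcons /= mem_rcons mem_head eqxx /=.
  rewrite bufE -filter_predI; apply: eq_in_filter => v _ /=.
  by rewrite mem_rcons inE negb_or.
- move=> q; rewrite /unzip1 map_rcons mem_rcons inE -/(unzip1 _) /=.
  have [->|qp] := eqVneq q p; last by rewrite other // sentE.
  by rewrite full andbT /= (leq_ltn_trans _ bp).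
- by rewrite /unzip1 map_rcons rcons_uniq -/(unzip1 _) pns.
- by rewrite filter_rcons /= pns bufE.
- move=> q; have [->|qp] := eqVneq q p; last by rewrite other.
  by rewrite full andbF (negbTE pns).
- by [].
Qed.

Lemma foldl_receive_ok t r x u : cells_ok (r ++ pmap id u) -> port_ok r x ->
  port_ok (r ++ pmap id u) (foldl (receive t) x u).
Proof.
elim: u r x => [|[pb|] u IH] r x /=; rewrite ?cats0 //; last by move=> ? ?; apply: IH.
rewrite -cat_rcons => h xr; apply: IH => //; apply: receive_ok => //.
move: h => [u1 u2]; split; first by move: u1; rewrite cat_uniq => /and3P[].
by move=> v vr; apply: u2; rewrite mem_cat vr.
Qed.

Definition received j n : seq (packet N * nat) :=
  pmap id (flatten (take (completed j n) (headlog j n))).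

Lemma completed_le j n : completed j n <= size (headlog j n).
Proof. exact: leq_trans (leq_subr _ _) (started_le fl new ok j n). Qed.

Lemma completed_step j n : completed j n.+1 <= (completed j n).+1.
Proof.
have := out_nextP j n; rewrite /out_next.
by case: ifP => _ []; [move=> _ -> _|move=> -> _].
Qed.

Lemma completed_mono j x y : x <= y -> completed j x <= completed j y.
Proof.
move=> xy; rewrite -(subnKC xy); elim: (y - x) => [|d IH]; first by rewrite addn0.
rewrite addnS; apply: leq_trans IH _; have := out_nextP j (x + d); rewrite /out_next.
by case: ifP => _ []; [move=> _ -> _|move=> -> _].
Qed.

Lemma receivedS j n : received j n.+1 = received j n ++
  (if sends j n && ((phase j n).+1 == N)
   then pmap id (nth [::] (headlog j n) (completed j n)) else [::]).
Proof.
have := out_nextP j n; rewrite /out_next /received.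
have [s ->] := headlog_prefix fl new ok j (leqnSn n).
case: ifP => _ [].
  move=> h -> _; rewrite takel_cat // (take_nth [::]) //.
  by rewrite flatten_rcons pmap_cat.
by move=> -> _; rewrite takel_cat ?cats0 // completed_le.
Qed.

Section Port.
Variable j : 'I_N.
Hypothesis cells_okP : forall n, cells_ok (received j n).

Lemma out_port_ok n : port_ok (received j n) (st_out (st n) j).
Proof.
elim: n => [|n IH]; first by split=> // p /=; case: (len p).
have := cells_okP n.+1; rewrite receivedS; have := out_nextP j n; rewrite /out_next.
case: ifP => _ []; last first.
  by move=> _ e _; rewrite cats0; apply: port_ok_data IH; rewrite e.
move=> _ _ e h; apply: port_ok_data (foldl_receive_ok (slot_end n) h IH).
by rewrite e.
Qed.

Lemma op_sent_prefix x y : x <= y ->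
  exists s, op_sent (st_out (st y) j) = op_sent (st_out (st x) j) ++ s.
Proof.
apply: (@prefix_mono _ (fun n => op_sent (st_out (st n) j))) => n.
have := out_nextP j n; rewrite /out_next; case: ifP => _ []; last first.
  by move=> _ [_ _ ->]; exists [::]; rewrite cats0.
move=> _ _ [_ _ ->].
elim: (nth _ _ _) (st_out (st n) j) => [|[pb|] u IH] x0 //=; first by exists [::]; rewrite cats0.
have [s ->] := IH (receive (slot_end n) x0 (Some pb)); rewrite /receive.
case: ifP => _ /=; last by exists s.
by rewrite cat_rcons; eexists.
Qed.

Local Open Scope ring_scope.

Definition line_work (s : seq (packet N * R)) : R :=
  (\sum_(q <- s) (len q.1)%:R) / cP c.

(** Every packet is sent in a busy period of the line: [s2] lists what has been
    sent since its beginning, at the end of slot [n0], and nothing in [s2] had been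
    sent when slot [n0] began. *)
Definition line_ok (x : out_port c) : Prop :=
  (exists n0 s' s2, op_sent x = op_sent (st_out (st n0) j) ++ s' ++ s2 /\
     op_free x <= slot_end n0 + line_work s2) /\
  (forall p d, (p, d) \in op_sent x ->
   exists n0 s' s2 s3,
     op_sent x = op_sent (st_out (st n0) j) ++ s' ++ rcons s2 (p, d) ++ s3 /\
     d <= slot_end n0 + line_work (rcons s2 (p, d))).

Lemma line_ok_receive n x u : (exists s, op_sent x = op_sent (st_out (st n) j) ++ s) ->
  line_ok x -> line_ok (receive (slot_end n) x u).
Proof.
case: u => [[p b]|] // [s0 xs] [[n0 [s' [s2 [xE fE]]]] mE].
rewrite /receive; case: ifP => _ /=; last by split=> //; exists n0, s', s2.
set d := Num.max _ _ + _.
have work_rcons (l : seq (packet N * R)) :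
    line_work (rcons l (p, d)) = line_work l + (len p)%:R / cP c.
  by rewrite /line_work -cats1 big_cat big_seq1 /= mulrDl.
have [m [t' [t2 [xE' dE]]]] : exists n0 s' s2,
    op_sent x = op_sent (st_out (st n0) j) ++ s' ++ s2 /\
    d <= slot_end n0 + line_work (rcons s2 (p, d)).
  (* If the line is idle, a busy period begins with this packet at the end of slot [n]; otherwise
     the packet extends the current one. *)
  have [ft|tf] := leP (op_free x) (slot_end n).
    exists n, s0, [::]; rewrite cats0; split=> //.
    by rewrite work_rcons /line_work big_nil mul0r add0r /d max_r.
  exists n0, s', s2; split=> //; rewrite work_rcons addrA /d max_l ?(ltW tf) //.
  by rewrite lerD2r.
split=> [|p' d'].
  by exists m, t', (rcons t2 (p, d)); rewrite /= xE' -!rcons_cat; split.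
rewrite /= mem_rcons inE => /predU1P[[-> ->]|/mE[m' [u' [u2 [u3 [e h]]]]]].
  by exists m, t', t2, [::]; rewrite cats0 xE' -!rcons_cat.
by exists m', u', u2, (rcons u3 (p, d)); rewrite e -!rcons_cat.
Qed.

Lemma line_ok_data (x y : out_port c) : port_data x = port_data y ->
  line_ok x -> line_ok y.
Proof. by rewrite /line_ok => -[_ -> ->]. Qed.

Lemma slot_end_ge0 : 0 < eps -> forall n, 0 <= slot_end n.
Proof.
move=> e0 n; rewrite /slot_end /slot_time; have := okP ok => P0.
by rewrite mulr_ge0 // divr_ge0 // !mulr_ge0 // ?ltW //; lra.
Qed.

Lemma line_okP n : 0 < eps -> line_ok (st_out (st n) j).
Proof.
move=> e0; elim: n => [|n IH].
  split=> //; exists 0%N, [::], [::]; split=> //=.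
  by rewrite /line_work big_nil mul0r addr0 slot_end_ge0.
have := out_nextP j n; rewrite /out_next; case: ifP => _ []; last first.
  by move=> _ e; apply: line_ok_data IH; rewrite e.
move=> _ _ e; apply: line_ok_data (esym e) _.
have : exists s, op_sent (st_out (st n) j) = op_sent (st_out (st n) j) ++ s.
  by exists [::]; rewrite cats0.
elim: (nth _ _ _) {1 2 4}(st_out (st n) j) IH => //= v u IH x xl xs.
apply: IH; first exact: line_ok_receive.
case: xs => s xs; rewrite /receive; case: v => [pb|]; last by exists s.
by case: ifP => _ /=; rewrite ?xs ?rcons_cat; eexists.
Qed.

End Port.

End Refinement.

(** * Traffic and the output-queued switch *)

Section SumSub.
Variables (T : eqType) (F : T -> nat).

Lemma leq_sum_sub (s1 s2 : seq T) : uniq s1 -> {subset s1 <= s2} ->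
  (\sum_(x <- s1) F x <= \sum_(x <- s2) F x)%N.
Proof.
elim: s1 s2 => [|x s1 IH] s2 /=; first by rewrite big_nil.
move=> /andP[xs1 us1] s12.
rewrite (perm_big _ (perm_to_rem (s12 x (mem_head x s1)))) !big_cons leq_add2l.
apply: IH => // y ys1; have : y \in s2 by apply: s12; rewrite inE ys1 orbT.
rewrite (perm_mem (perm_to_rem (s12 x (mem_head x s1)))) inE.
by case: eqP => // yx; move: xs1; rewrite -yx ys1.
Qed.

Lemma split_first (p : pred T) (l : seq T) : has p l ->
  exists l1 x l2, [/\ l = l1 ++ x :: l2, p x & ~~ has p l1].
Proof.
elim: l => //= y l IH; have [py _|npy /= /IH[l1 [x [l2 [-> px h]]]]] := boolP (p y).
  by exists [::], y, l.
by exists (y :: l1), x, l2; split=> //=; rewrite (negbTE npy).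
Qed.

End SumSub.

Section Traffic.
Local Open Scope ring_scope.
Variables (R : realType) (c : config R) (eps : R) (tr : traffic c) (Lmax : nat).
Hypothesis ok : config_ok c.
Hypothesis eps0 : 0 < eps.
Hypothesis tok : traffic_ok Lmax tr.
Local Notation N := (cN c).
Local Notation P := (cP c).
Local Notation slot := (slot_time c eps).
Let P0 : 0 < P := okP ok.

Lemma slot_gt0 : 0 < slot.
Proof.
by rewrite /slot_time divr_gt0 ?ltr0n ?(okk ok) // !mulr_gt0 ?ltr0n ?(okN ok) // addr_gt0.
Qed.

Lemma arrP i t a :
  reflect (exists2 n, tr i n = Some a & a.1 <= t) (a \in arrived tr i t).
Proof. by apply: (iffP idP) => /(mem_arrived i t a P0 tok). Qed.

Lemma arrival_gap i m n a b : (m < n)%N -> tr i m = Some a -> tr i n = Some b ->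
  a.1 + (len b.2)%:R / P <= b.1.
Proof.
elim: n b => // n IH b; rewrite ltnS leq_eqVlt => /orP[/eqP ->|mn] am bn.
  by have [a' a'n h] := tr_next tok bn; move: am; rewrite a'n => -[<-].
have [a' a'n] := tr_next tok bn; apply: le_trans; rewrite lerD2r.
apply: le_trans (IH _ mn am a'n); rewrite lerDl divr_ge0 ?ler0n //; exact: ltW.
Qed.

Lemma arrival_gt0 i n a : tr i n = Some a -> 0 < a.1.
Proof.
have first b : tr i 0%N = Some b -> 0 < b.1.
  move=> b0; apply: lt_le_trans (tr_first tok b0).
  by rewrite divr_gt0 // ltr0n; have /andP[] := tr_len tok b0.
elim: n a => [|n IH] a an; first exact: first.
have [b bn h] := tr_next tok an; apply: lt_le_trans (IH _ bn) _.
apply: le_trans h; rewrite lerDl divr_ge0 ?ler0n //; exact: ltW.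
Qed.

Lemma arrived_uniq i t : uniq (arrived tr i t).
Proof.
apply: filter_uniq; have := iota_uniq 0 (Num.truncn (P * t)).
elim: (iota _ _) => //= n l IH /andP[nl /IH ul].
case an: (tr i n) => [a|] //=; rewrite ul andbT mem_pmap.
apply/negP => /mapP[m ml am]; move/negP: nl; apply.
by rewrite -(tr_id tok an).2 (tr_id tok (esym am)).2.
Qed.

Lemma arrived_split i t t' : t <= t' ->
  perm_eq (arrived tr i t') (arrived tr i t ++ [seq a <- arrived tr i t' | t < a.1]).
Proof.
move=> tt'; apply: uniq_perm; rewrite ?arrived_uniq //.
  rewrite cat_uniq arrived_uniq filter_uniq ?arrived_uniq // andbT.
  apply/hasPn => a; rewrite mem_filter => /andP[ta _]; apply/negP => /arrP[n _].
  by rewrite leNgt ta.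
move=> a; rewrite mem_cat [X in _ = _ || X]mem_filter; have [ta|at_] := ltP t a.1.
  rewrite /=; case e: (a \in arrived tr i t) => //.
  have /arrP[n _] : a \in arrived tr i t by rewrite e.
  by rewrite leNgt ta.
rewrite /= orbF; apply/idP/idP => /arrP[n an h]; apply/arrP; exists n => //.
exact: le_trans h tt'.
Qed.

(** The reception intervals of one input are disjoint, so only a packet whose reception began before
    [t] can exceed the line rate, by at most [Lmax] bytes. *)
Lemma arrived_window i t t' : t <= t' ->
  (\sum_(a <- arrived tr i t' | t < a.1) len a.2)%:R <= P * (t' - t) + Lmax%:R :> R.
Proof.
rewrite /arrived big_filter_cond; move: (Num.truncn _) => m.
elim: m t t' => [|m IH] t t' tt'.
  by rewrite big_nil addr_ge0 ?ler0n // mulr_ge0 ?subr_ge0 ?(ltW P0).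
rewrite -addn1 iotaD pmap_cat big_cat /= add0n.
case em: (tr i m) => [b|] /=; last by rewrite big_nil addn0; apply: IH.
rewrite big_cons big_nil; case: ifP => [/andP[bt' tb]|_]; last first.
  by rewrite addn0; apply: IH.
rewrite addn0 natrD.
have early a : a \in pmap (tr i) (iota 0 m) -> a.1 <= b.1 - (len b.2)%:R / P.
  rewrite mem_pmap => /mapP[n]; rewrite mem_iota add0n => /andP[_ nm] /esym an.
  by rewrite lerBrDr (arrival_gap nm an em).
have lenb : (len b.2)%:R <= Lmax%:R :> R.
  by rewrite ler_nat; have /andP[] := tr_len tok em.
set t'' := b.1 - (len b.2)%:R / P in early.
have l0 : 0 <= (len b.2)%:R / P :> R by rewrite divr_ge0 ?ler0n ?ltW.
(* The reception of [b] starts at [t''], when all earlier packets are complete. If this is before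
   [t], only [b] is counted; otherwise the induction covers the time up to [t'']. *)
have [le|lt] := leP t t''; last first.
  rewrite big_seq_cond big_pred0.
    by rewrite add0r (le_trans lenb) // lerDr mulr_ge0 ?subr_ge0 ?(ltW P0).
  move=> a; case ha: (_ \in _) => //=; have := early a ha.
  by case: (ltP t a.1) => h; rewrite ?andbF //; move: h lt; lra.
rewrite big_seq_cond (eq_bigl (fun a : arrival c => (a \in pmap (tr i) (iota 0 m)) &&
    ((a.1 <= t'') && (t < a.1)))); last first.
  move=> a; case ha: (_ \in _) => //=; have ea := early a ha.
  by rewrite ea; congr (_ && _); apply/idP; move: ea bt' l0; rewrite /t''; lra.
rewrite -big_seq_cond; have := IH _ _ le.
have : P * (t'' - t) + (len b.2)%:R <= P * (t' - t).
  have e : P * ((len b.2)%:R / P) = (len b.2)%:R :> R by rewrite mulrC divfK ?gt_eqF.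
  have : 0 <= P * (t' - b.1) by rewrite mulr_ge0 ?subr_ge0 ?(ltW P0).
  by rewrite /t''; move: e; set l := _ / P; lra.
lra.
Qed.

Definition accepted i n : seq (packet N) :=
  flatten [seq new_packets eps tr s i | s <- iota 0 n].

Lemma acceptedS i n : accepted i n.+1 = accepted i n ++ new_packets eps tr n i.
Proof. by rewrite /accepted -addn1 iotaD map_cat flatten_cat /= cats0. Qed.

(** Slot [s] accepts the packets received up to [s * slot], so those accepted before
    slot [n] are those received up to [horizon n]. *)
Definition horizon (n : nat) : R := (n%:R - 1) * slot.

Lemma horizonS n : horizon n.+1 = n%:R * slot.
Proof. by rewrite /horizon -natr1 addrK. Qed.

Lemma horizon_le m n : (m <= n)%N -> horizon m <= horizon n.
Proof. by move=> mn; rewrite /horizon ler_pM2r ?slot_gt0 // lerD2r ler_nat. Qed.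

Lemma accepted_perm i n :
  perm_eq (accepted i n) [seq a.2 | a <- arrived tr i (horizon n)].
Proof.
elim: n => [|n IH].
  have -> : arrived tr i (horizon 0) = [::]; last by [].
  case e: (arrived _ _ _) => [//|a l].
  have /arrP[n /arrival_gt0] : a \in arrived tr i (horizon 0) by rewrite e mem_head.
  rewrite /horizon sub0r mulN1r => a0 /(lt_le_trans a0).
  by rewrite oppr_gt0 ltNge (ltW slot_gt0).
rewrite acceptedS (perm_trans _ (perm_map _ (_ : perm_eq (arrived tr i (horizon n) ++
  [seq a <- arrived tr i (horizon n.+1) | horizon n < a.1]) _))) //; last first.
  by rewrite perm_sym; apply/arrived_split/horizon_le.
by rewrite map_cat perm_cat // /new_packets horizonS.
Qed.

Lemma acceptedP i n p : reflect (exists2 a, a.2 = p & exists2 s, tr i s = Some a & a.1 <= horizon n)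
  (p \in accepted i n).
Proof.
rewrite (perm_mem (accepted_perm i n)); apply: (iffP mapP) => [[a /arrP h ->]|[a <- h]].
  by exists a.
by exists a => //; apply/arrP.
Qed.

Lemma accepted_uniq i n : uniq (accepted i n).
Proof.
rewrite (perm_uniq (accepted_perm i n)) map_inj_in_uniq ?arrived_uniq //.
move=> a b /arrP[m am _] /arrP[l bl _] e.
have ml : m = l by rewrite -(tr_id tok am).2 e (tr_id tok bl).2.
by move: am; rewrite ml bl => -[].
Qed.

Lemma accepted_src i n p : p \in accepted i n -> src p = i.
Proof. by case/acceptedP => a <- [s /(tr_id tok)[]]. Qed.

Definition bytes_in i n : nat := (\sum_(p <- accepted i n) len p)%N.

Definition bytes_to j n : nat :=
  (\sum_(i < N) \sum_(p <- accepted i n | dst p == j) len p)%N.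

Lemma bytes_in_window i x y : (x <= y)%N ->
  (bytes_in i y)%:R <= (bytes_in i x)%:R + P * slot * (y%:R - x%:R) + Lmax%:R :> R.
Proof.
move=> xy; have h := horizon_le xy.
have -> : bytes_in i y = (bytes_in i x +
    \sum_(a <- arrived tr i (horizon y) | (horizon x < a.1)%R) len a.2)%N.
  rewrite /bytes_in !(perm_big _ (accepted_perm i _)) !big_map.
  rewrite (perm_big _ (arrived_split i h)) big_cat /=; congr addn.
  by rewrite -[RHS]big_filter.
rewrite natrD -addrA lerD2l; apply: le_trans (arrived_window i h) _.
rewrite lerD2r -mulrA ler_pM2l // /horizon.
by rewrite -mulrBl opprB addrA subrK mulrC.
Qed.

Lemma sum_bytes_to n : (\sum_(j < N) bytes_to j n = \sum_(i < N) bytes_in i n)%N.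
Proof.
rewrite exchange_big; apply: eq_bigr => i _; rewrite /bytes_in.
by rewrite [RHS](partition_big (fun p : packet N => dst p) xpredT).
Qed.

Lemma bytes_to_mono j x y : (x <= y)%N -> (bytes_to j x <= bytes_to j y)%N.
Proof.
move=> xy; rewrite -(subnKC xy); elim: (y - x)%N => [|d IH]; first by rewrite addn0.
rewrite addnS; apply: leq_trans IH _; apply: leq_sum => i _.
by rewrite acceptedS big_cat leq_addr.
Qed.

Lemma bytes_window x y : (x <= y)%N -> (\sum_(i < N) bytes_in i y)%:R <=
  (\sum_(i < N) bytes_in i x)%:R + N%:R * (P * slot * (y%:R - x%:R) + Lmax%:R) :> R.
Proof.
move=> xy; rewrite !natr_sum -[N in N%:R * _]card_ord mulr_natl -sumr_const -big_split.
by apply: ler_sum => i _ /=; rewrite addrA bytes_in_window.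
Qed.

Lemma bytes_to_window j x y : (x <= y)%N -> (bytes_to j y)%:R <=
  (bytes_to j x)%:R + N%:R * (P * slot * (y%:R - x%:R) + Lmax%:R) :> R.
Proof.
move=> xy; have := bytes_window xy; rewrite -!sum_bytes_to.
rewrite (bigD1 j) //= (bigD1 (F := fun i => bytes_to i x) j) //=.
have : (\sum_(i < N | i != j) bytes_to i x <= \sum_(i < N | i != j) bytes_to i y)%N.
  by apply: leq_sum => i _; apply: bytes_to_mono.
by rewrite -(ler_nat R) !natrD; lra.
Qed.

Definition arrivals t : seq (arrival c) :=
  flatten [seq arrived tr i t | i : 'I_N <- enum 'I_N].

Lemma arrivalsP t a :
  reflect (exists i n, tr i n = Some a /\ a.1 <= t) (a \in arrivals t).
Proof.
apply: (iffP flattenP) => [[s /mapP[i _ ->] /arrP[n an h]]|[i [n [an h]]]].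
  by exists i, n.
exists (arrived tr i t); first by apply/mapP; exists i; rewrite ?mem_enum.
by apply/arrP; exists n.
Qed.

Lemma arrivals_uniq t : uniq (arrivals t).
Proof.
rewrite /arrivals; have := enum_uniq 'I_N; elim: (enum 'I_N) => //= i l IH /andP[il ul].
rewrite cat_uniq arrived_uniq IH // andbT /=.
apply/hasPn => a /flattenP[s /mapP[i' i'l ->]] /arrP[n /(tr_id tok)[ai' _] _].
apply/negP => /arrP[m /(tr_id tok)[ai _] _].
by move: il; rewrite -ai ai' i'l.
Qed.

Lemma bytes_toE j n :
  bytes_to j n = (\sum_(a <- arrivals (horizon n) | dst a.2 == j) len a.2)%N.
Proof.
rewrite /bytes_to /arrivals big_flatten /= big_map big_enum /=.
by apply: eq_bigr => i _; rewrite (perm_big _ (accepted_perm i n)) big_map.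
Qed.

(** [fifo_le] looks only at times and inputs. Packets of one input have positive lengths, hence
    distinct times, which makes the order antisymmetric on arrivals and the sorted list unique. *)
Lemma arrival_inj i m i' n a b : tr i m = Some a -> tr i' n = Some b ->
  a.1 = b.1 -> src a.2 = src b.2 -> a = b.
Proof.
move=> am bn ab1 sab.
have ii' : i = i' by rewrite -(tr_id tok am).1 sab (tr_id tok bn).1.
rewrite -{}ii' in bn.
have gap m' n' a' b' : tr i m' = Some a' -> tr i n' = Some b' -> a'.1 = b'.1 -> ~~ (m' < n')%N.
  move=> am' bn' e; apply/negP => /arrival_gap /(_ am' bn').
  rewrite e gerDl; apply/negP; rewrite -ltNge divr_gt0 // ltr0n.
  by have /andP[] := tr_len tok bn'.
have := gap _ _ _ _ am bn ab1; have := gap _ _ _ _ bn am (esym ab1).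
by case: ltngtP => // e _ _; move: am; rewrite -e bn => -[].
Qed.

(** * Exit times of the output-queued switch *)

Lemma fifo_le_total : total (@fifo_le R c).
Proof.
move=> a b; rewrite /fifo_le (eq_sym b.1); case: ltgtP => //= _; exact: leq_total.
Qed.

Lemma fifo_le_trans : transitive (@fifo_le R c).
Proof.
move=> b a d; rewrite /fifo_le => /orP[ab|/andP[/eqP -> ab]] /orP[bd|/andP[/eqP <- bd]].
- by rewrite (lt_trans ab bd).
- by rewrite ab.
- by rewrite bd.
- by rewrite eqxx (leq_trans ab bd) orbT.
Qed.

Lemma fifo_le_time (a b : arrival c) : fifo_le a b -> a.1 <= b.1 :> R.
Proof. by rewrite /fifo_le => /orP[/ltW|/andP[/eqP ->]]. Qed.

Lemma fifo_le_refl (a : arrival c) : fifo_le a a.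
Proof. by rewrite /fifo_le eqxx leqnn orbT. Qed.

Definition is_arrival (a : arrival c) : Prop := exists i n, tr i n = Some a.

Lemma oq_uptoP a b : reflect
  (is_arrival b /\ dst b.2 = dst a.2 /\ fifo_le b a) (b \in oq_upto tr a).
Proof.
rewrite /oq_upto mem_sort mem_filter -/(arrivals a.1).
apply: (iffP andP) => [[/andP[/eqP d f] /arrivalsP[i [n [bn _]]]]|].
  by do 2?split=> //; exists i, n.
move=> [[i [n bn]] [d f]]; rewrite d eqxx f; split=> //.
by apply/arrivalsP; exists i, n; split=> //; apply: fifo_le_time.
Qed.

Lemma oq_upto_uniq a : uniq (oq_upto tr a).
Proof. by rewrite sort_uniq filter_uniq // arrivals_uniq. Qed.

Lemma fifo_le_anti a b : is_arrival a -> is_arrival b ->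
  fifo_le a b -> fifo_le b a -> a = b.
Proof.
move=> [i [m am]] [i' [n bn]]; rewrite /fifo_le (eq_sym b.1).
case: ltgtP => //= e ab ba; apply: (arrival_inj am bn e).
by apply/val_inj/eqP; rewrite /= eqn_leq ab ba.
Qed.

(** Makes the exit time of [b] an intermediate value of the fold that computes the exit time of
    [a]. *)
Lemma oq_upto_split a b l1 l2 : oq_upto tr a = l1 ++ b :: l2 -> oq_upto tr b = rcons l1 b.
Proof.
move=> e; have mem x : x \in l1 ++ b :: l2 -> is_arrival x /\ dst x.2 = dst a.2.
  by rewrite -e => /oq_uptoP[? []].
have srt : sorted (@fifo_le R c) (l1 ++ b :: l2).
  by rewrite -e; apply: sort_sorted; exact: fifo_le_total.
have un : uniq (l1 ++ b :: l2) by rewrite -e oq_upto_uniq.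
have [bA bd] : is_arrival b /\ dst b.2 = dst a.2.
  by apply: mem; rewrite mem_cat mem_head orbT.
have upA x : x \in oq_upto tr b -> is_arrival x by case/oq_uptoP.
apply: (sorted_eq_in (leT := @fifo_le R c)).
- by move=> x y z _ _ _; exact: fifo_le_trans.
- by move=> x y /upA xA /upA yA /andP[]; exact: fifo_le_anti.
- by apply: sort_sorted; exact: fifo_le_total.
- by move: srt; rewrite -cat_rcons => /cat_sorted2[].
apply: uniq_perm; first exact: oq_upto_uniq.
  by move: un; rewrite -cat_rcons cat_uniq => /and3P[].
move: srt; rewrite sorted_pairwise; last exact: fifo_le_trans.
rewrite pairwise_cat /= => /and3P[/allrelP l1b _ /andP[/allP bl2 _]].
move=> x; apply/idP/idP => [/oq_uptoP[xA [xd xb]]|].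
  have : x \in oq_upto tr a.
    apply/oq_uptoP; split=> //; split; first by rewrite xd.
    apply: fifo_le_trans xb _.
    have : b \in oq_upto tr a by rewrite e mem_cat mem_head orbT.
    by case/oq_uptoP => _ [].
  rewrite e mem_cat inE mem_rcons inE; case: (x \in l1) => /=; first by rewrite orbT.
  case: eqP => //= xb'; move/bl2 => bx; case: xb'; exact: fifo_le_anti.
rewrite mem_rcons inE => xl; apply/oq_uptoP.
have xm : x \in l1 ++ b :: l2.
  by rewrite mem_cat inE; case/predU1P: xl => [->|->]; rewrite ?eqxx ?orbT.
have [xA xd] := mem _ xm; split=> //; split; first by rewrite xd bd.
case/predU1P: xl => [->|xl]; first exact: fifo_le_refl.
by apply: l1b; rewrite ?mem_head.
Qed.

(** What is received from [t] on is sent after [t], one packet after another at rate [P]. The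
    disjunction ensures that the line is in use after [t] at all; otherwise the fold could end
    before [t]. *)
Lemma serve_ge l f (t : R) : has (fun b : arrival c => t <= b.1) l \/ t <= f ->
  t + (\sum_(b <- l | t <= b.1) len b.2)%:R / P <= foldl (@serve R c) f l.
Proof.
elim/last_ind: l => [[]// tf|l b IH h]; first by rewrite big_nil mul0r addr0.
rewrite -cats1 foldl_cat /= big_cat /= big_mkcond [X in (_ + X)%N]big_mkcond big_seq1 -big_mkcond.
rewrite /serve; have l0 : 0 <= (len b.2)%:R / P by rewrite divr_ge0 ?ler0n ?(ltW P0).
have [tb|bt] := leP t b.1; last first.
  rewrite addn0; apply: (@le_trans _ _ (foldl (@serve R c) f l)).
    apply: IH; move: h; rewrite has_rcons (leNgt t b.1) bt /=; exact.
  by rewrite (le_trans (_ : _ <= Num.max (foldl (@serve R c) f l) b.1)) ?le_max ?lexx // lerDl.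
rewrite natrD mulrDl addrA lerD2r.
(* If [b] is the first packet received since [t], its own arrival time replaces the induction
   hypothesis. *)
have [hl|/hasPn nl] := boolP (has (fun b : arrival c => t <= b.1) l).
  by rewrite le_max IH //; left.
rewrite big_seq_cond big_pred0; first by rewrite mul0r addr0 le_max tb orbT.
by move=> x; case xl: (_ \in _) => //=; apply: negbTE; exact: nl.
Qed.

Lemma oq_exit_ge a : is_arrival a -> a.1 <= oq_exit tr a.
Proof.
move=> aA; apply: le_trans (serve_ge (t := a.1) _); last first.
  left; apply/hasP; exists a; rewrite ?lexx //; apply/oq_uptoP.
  by do 2?split=> //; exact: fifo_le_refl.
by rewrite lerDl divr_ge0 ?ler0n ?(ltW P0).
Qed.

(** All bytes for this output received between [horizon x] and [horizon s] precede [a] in FIFO order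
    and are sent after [horizon x]. *)
Lemma oq_exit_bytes a x s : is_arrival a -> (x <= s)%N -> horizon s < a.1 ->
  horizon x + ((bytes_to (dst a.2) s)%:R - (bytes_to (dst a.2) x)%:R) / P <= oq_exit tr a.
Proof.
move=> aA xs sa; have xh := horizon_le xs.
have aup : a \in oq_upto tr a.
  by apply/oq_uptoP; do 2?split=> //; exact: fifo_le_refl.
apply: le_trans (serve_ge (t := horizon x) _); last first.
  by left; apply/hasP; exists a => //; apply: ltW (le_lt_trans xh sa).
rewrite lerD2l ler_pM2r ?invr_gt0 // lerBlDl -natrD ler_nat !bytes_toE.
have -> : (\sum_(b <- arrivals (horizon s) | dst b.2 == dst a.2) len b.2 =
  \sum_(b <- arrivals (horizon s) | (dst b.2 == dst a.2) && (b.1 <= horizon x)%R) len b.2 +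
  \sum_(b <- arrivals (horizon s) | (dst b.2 == dst a.2) && (horizon x < b.1)%R) len b.2)%N.
  rewrite (bigID (fun b : arrival c => b.1 <= horizon x)) /=; congr addn.
  by apply: eq_bigl => b; rewrite ltNge.
apply: leq_add.
  rewrite -!(big_filter _ (fun b : arrival c => _ && _)) -[X in (_ <= X)%N]big_filter.
  apply: leq_sum_sub; first by rewrite filter_uniq ?arrivals_uniq.
  move=> b; rewrite !mem_filter => /andP[/andP[-> bx] /arrivalsP[i [n [bn _]]]] /=.
  by apply/arrivalsP; exists i, n.
rewrite -(big_filter _ (fun b : arrival c => _ && _)) -[X in (_ <= X)%N]big_filter.
apply: leq_sum_sub; first by rewrite filter_uniq ?arrivals_uniq.
move=> b; rewrite !mem_filter => /andP[/andP[/eqP bd bx] /arrivalsP[i [n [bn bs]]]] /=.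
rewrite (ltW bx); apply/oq_uptoP; split; first by exists i, n.
by split=> //; rewrite /fifo_le (le_lt_trans bs sa).
Qed.

(** Let [b] be the first packet of [S] in FIFO order. It exits at [y] or later, and the other
    packets of [S] are sent between its exit and that of [a]; only the bytes of [b] itself, at most
    [Lmax], may have been sent before [y]. *)
Lemma oq_exit_work a (S : seq (arrival c)) (y : R) : is_arrival a -> uniq S ->
  {subset S <= oq_upto tr a} -> has predT S -> (forall b, b \in S -> y <= oq_exit tr b) ->
  (\sum_(b <- S) len b.2)%:R <= P * (oq_exit tr a - y) + Lmax%:R.
Proof.
move=> aA uS SU hS Sy.
have : has (mem S) (oq_upto tr a).
  by case/hasP: hS => b bS _; apply/hasP; exists b => //; apply: SU.
move=> /split_first[l1 [b [l2 [e bS nl1]]]].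
have : (\sum_(d <- S) len d.2 <= \sum_(d <- b :: l2) len d.2)%N.
  apply: leq_sum_sub => // d dS; have := SU _ dS; rewrite e mem_cat.
  by case/orP => // dl1; move/hasPn: nl1 => /(_ d dl1); rewrite /= dS.
rewrite -(ler_nat R) big_cons natrD => /le_trans; apply.
have lb : (len b.2)%:R <= Lmax%:R :> R.
  have : b \in oq_upto tr a by apply: SU.
  by case/oq_uptoP => -[i [n bn]] _; rewrite ler_nat; have /andP[] := tr_len tok bn.
have eE : oq_exit tr b = foldl (@serve R c) 0 (rcons l1 b).
  by rewrite /oq_exit (oq_upto_split e).
have : oq_exit tr b + (\sum_(d <- l2) len d.2)%:R / P <= oq_exit tr a.
  rewrite {2}/oq_exit e -cat_rcons foldl_cat -eE.
  elim: (l2) (oq_exit tr b) => [|d l IH] f /=; first by rewrite big_nil mul0r addr0.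
  apply: le_trans (IH _); rewrite big_cons natrD mulrDl addrA lerD2r lerD2r.
  by rewrite le_max lexx.
have := Sy b bS; rewrite -lerBrDl ler_pdivrMr // mulrC => yb h.
have : P * (oq_exit tr a - oq_exit tr b) <= P * (oq_exit tr a - y).
  by rewrite ler_pM2l // lerB.
by move: h lb; rewrite mulrC; lra.
Qed.

End Traffic.

(** * Bounded delay up to the HBM *)

Section Delay.
Local Open Scope nat_scope.
Variables (R : realType) (c : config R) (eps : R) (M Lmax : nat) (tr : traffic c).
Local Notation N := (cN c).
Local Notation k := (ck c).
Local Notation K := (cK c).
Local Notation W := (cK c %/ ck c).
Local Notation P := (cP c).
Local Notation slot := (slot_time c eps).
Local Notation new := (new_packets eps tr).
Local Notation fl := (dvdn M).
Local Notation inq := (inq fl new).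
Local Notation inlog := (inlog fl new).
Local Notation loaded := (loaded fl new).
Local Notation tailq := (tailq fl new).
Local Notation flog := (flog fl new).
Local Notation popped := (popped fl new).
Local Notation written := (written fl new).
Local Notation hbmq := (hbmq fl new).
Local Notation reads := (reads fl new).
Local Notation delivered := (delivered fl new).
Local Notation headlog := (headlog fl new).
Local Notation started := (started fl new).
Local Notation incount := (incount fl new).
Local Notation tailcount := (tailcount fl new).
Local Notation accepted := (accepted eps tr).
Local Notation bytes_in := (bytes_in eps tr).
Local Notation bytes_to := (bytes_to eps tr).
Local Notation tickM := (tick M 0).

Hypothesis ok : config_ok c.
Let N0 : 0 < N := okN ok.
Let k0 : 0 < k := okk ok.
Let K0 : 0 < K := okK ok.
Let WkK : W * k = K. Proof. by rewrite divnK // okkK. Qed.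
Let W0 : 0 < W. Proof. by rewrite divn_gt0 // dvdn_leq // okkK. Qed.
Let NW0 : 0 < N * W. Proof. by rewrite muln_gt0 N0. Qed.

Definition acccount (Q : pred (cell c)) i j n :=
  \sum_(p <- accepted i n | dst p == j) count Q (cells_of p).

Lemma acccountS Q i j n :
  acccount Q i j n.+1 = acccount Q i j n + newcount new Q i j n.
Proof. by rewrite /acccount acceptedS big_cat. Qed.

Lemma incount_acc Q i j n : Q None = false -> incount Q i j n = acccount Q i j n.
Proof.
move=> Q0; elim: n => [|n IH]; first by rewrite /acccount /= big_nil /incount /= /bcount big_nil.
by have [z _ ->] := incountS fl new ok i j n; rewrite IH acccountS Q0 addn0.
Qed.

Lemma flE n : fl n = periodic M 0 n. Proof. by rewrite /periodic addn0. Qed.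

Lemma leq_sum3 (F G F' G' : 'I_N -> nat) (a b : nat) :
  (forall j, F j + G j + a <= F' j + G' j + b) ->
  \sum_(j < N) F j + \sum_(j < N) G j + N * a <=
  \sum_(j < N) F' j + \sum_(j < N) G' j + N * b.
Proof.
move=> h; have : \sum_(j < N) (F j + G j + a) <= \sum_(j < N) (F' j + G' j + b).
  by apply: leq_sum => j _; apply: h.
by rewrite !big_split /= !sum_nat_const card_ord.
Qed.

Lemma size_cells (p : packet N) : size (cells_of p : seq (cell c)) = len p.
Proof. by rewrite size_map size_iota. Qed.

Lemma acccountT i j n :
  acccount predT i j n = \sum_(p <- accepted i n | dst p == j) len p.
Proof. by apply: eq_bigr => p _; rewrite count_predT size_cells. Qed.

Lemma sum_acccount i n : \sum_(j < N) acccount predT i j n = bytes_in i n.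
Proof.
under eq_bigr do rewrite acccountT.
by rewrite /bytes_in [RHS](partition_big (fun p : packet N => dst p) xpredT).
Qed.

Lemma sum_bcount l : all (fun b : batch c => size b.2 == k) l ->
  \sum_(j < N) bcount predT j l = k * size l.
Proof.
move=> /allP lk; rewrite /bcount.
transitivity (\sum_(b <- l) count predT b.2).
  by rewrite [RHS](partition_big (fun b : batch c => b.1) xpredT).
rewrite big_seq (eq_bigr (fun=> k)) => [|b /lk /eqP]; last by rewrite count_predT.
by rewrite -big_seq big_const_seq count_predT iter_addn_0.
Qed.

Lemma inlog_bytes i n : k * size (inlog i n) <= \sum_(j < N) incount predT i j n
  <= k * size (inlog i n) + N * k.
Proof.
have [qk lk] := inq_ok fl new ok i n.
rewrite /incount big_split /= sum_bcount // leq_addr leq_add2l /=.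
rewrite -[X in _ <= X * _]card_ord -sum_nat_const; apply: leq_sum => j _.
by rewrite count_predT ltnW.
Qed.

Definition loadcount_to (Q : pred (cell c)) j n :=
  \sum_(i < N) bcount Q j (take (loaded i n) (inlog i n)).

Lemma tailcount_load Q j n : Q None = false -> tailcount Q j n = loadcount_to Q j n.
Proof.
move=> Q0; elim: n => [|n IH].
  rewrite /tailcount /loadcount_to /= /fcount big_nil big1 // => i _.
  by rewrite /bcount big_nil.
have [z _ ->] := tailcountS fl new ok j n.
by rewrite IH Q0 addn0 /loadcount_to -sum_loaded.
Qed.

Lemma bcountT_le j l : all (fun b : batch c => size b.2 == k) l ->
  bcount predT j l <= k * size l.
Proof. by move=> /sum_bcount <-; rewrite (bigD1 j) //= leq_addr. Qed.

Lemma bcount_le_cat Q j (l1 l2 : seq (batch c)) : bcount Q j l1 <= bcount Q j (l1 ++ l2).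
Proof. by rewrite bcount_cat leq_addr. Qed.

Lemma loadcount_le Q j n : loadcount_to Q j n <= \sum_(i < N) incount Q i j n.
Proof.
apply: leq_sum => i _; rewrite /incount.
by rewrite -{2}(cat_take_drop (loaded i n) (inlog i n)) bcount_cat -addnA leq_addr.
Qed.

Definition frames_ok (l : seq (tframe c)) : bool :=
  all (fun f : tframe c => (size f.2 == W) && all (fun v => size v == k) f.2) l.

Lemma fcountT j l : frames_ok l -> fcount predT j l = K * size (frames_of j l).
Proof.
elim: l => [|f l IH] /=; first by rewrite /fcount big_nil muln0.
move=> /andP[/andP[/eqP fW fk] /IH lk].
rewrite /fcount big_cons /frames_of /= -/(fcount predT j l) lk.
case: eqP => //= _; rewrite mulnS count_predT (size_flatten_all fk) fW WkK //.
Qed.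

Lemma flog_ok n : frames_ok (flog n).
Proof. exact: (tailq_ok fl new ok n).2. Qed.

Lemma sum_frames_of l : \sum_(j < N) size (frames_of j l) = size (l : seq (tframe c)).
Proof.
under eq_bigr do rewrite size_map size_filter -sum1_count.
by rewrite -sum1_size [RHS](partition_big (fun f : tframe c => f.1) xpredT).
Qed.

Lemma tailq_bytes j n : count predT (flatten ((tailq n).1 j)) <= K.
Proof.
have [/(_ j)[qW qk] _] := tailq_ok fl new ok n.
rewrite count_predT (size_flatten_all qk) -[X in _ <= X]WkK leq_mul2r ltnW ?orbT //.
Qed.

Lemma frames_of_cat j (l1 l2 : seq (tframe c)) :
  frames_of j (l1 ++ l2) = frames_of j l1 ++ frames_of j l2 :> seq (seq (seq (cell c))).
Proof. by rewrite /frames_of filter_cat map_cat. Qed.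

Lemma delivered_reads j n : reads j (n - W) <= delivered j n.
Proof.
have [nW|Wn] := leqP W n; last by have -> : n - W = 0 by lia.
rewrite -{2}(subnK nW); apply: latch_lb => //; exact: reads_mono.
Qed.

Lemma size_headlog j n : size (headlog j n) = W * delivered j n.
Proof.
have dl := delivered_le fl new ok j n.
rewrite /headlog (@size_flatten_all _ W).
  by rewrite size_takel // mulnC.
apply/allP => bs /mem_take /mapP[f]; rewrite mem_filter => /andP[_ /mem_take fn] ->.
by have /allP /(_ f fn) /andP[] := flog_ok n.
Qed.

(** A frame of [W] batches comes at most once per [N * W] slots, and a batch is sent every [N]
    slots. The burst is [N * W] for the rounding of the read schedule and [W] for the window that a
    read lasts; [2 * N] comes from [served_backlog]. *)
Definition head_backlog := N * W + W + 2 * N.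

Lemma started_backlog j n : size (headlog j n) <= started j n + head_backlog.
Proof.
apply: (@served_backlog N j N0 (fun n => size (headlog j n)) _ (N * W + W)).
- exact: headlog_size_mono.
  by rewrite size_headlog muln0.
move=> x y xy; rewrite !size_headlog.
have h1 := delivered_reads j x; have h2 := delivered_le_reads fl new j y.
have xWy : x - W <= y by lia.
have := served_tick ((N - j) * W) NW0 (fun n => size (hbmq j n)) xWy.
rewrite -/(reads j y) -/(reads j (x - W)) => h3.
have := tick_ub ((N - j) * W) NW0 xWy.
have : N * W * (reads j y + tick (N * W) ((N - j) * W) (x - W)) <=
       N * W * (reads j (x - W) + tick (N * W) ((N - j) * W) y) by rewrite leq_mul2l h3 orbT.
have : N * W * delivered j y <= N * W * reads j y by rewrite leq_mul2l h2 orbT.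
have : N * W * reads j (x - W) <= N * W * delivered j x by rewrite leq_mul2l h1 orbT.
rewrite !mulnDr !mulnA; lia.
Qed.

Lemma flush_inq i j n : fl n -> (inq i n.+1).1 j = [::].
Proof.
move=> fn /=; case: (foldl _ _ _) => q f /=.
by rewrite fn; case: eqP.
Qed.

Lemma flush_tailq j n : fl n -> (tailq n.+1).1 j = [::].
Proof.
by move=> fn /=; rewrite fn; case: (tail_in _ _ j) => [|a l]; rewrite ?orbT ?andbF //= orbF; case: ifP.
Qed.

Lemma bcount_mono Q i j x y : x <= y -> bcount Q j (inlog i x) <= bcount Q j (inlog i y).
Proof. by move=> xy; have [s ->] := inlog_prefix fl new i xy; exact: bcount_le_cat. Qed.

Lemma fcount_mono Q j x y : x <= y -> fcount Q j (flog x) <= fcount Q j (flog y).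
Proof. by move=> xy; have [s ->] := flog_prefix fl new xy; rewrite fcount_cat leq_addr. Qed.

(** * Bounded backlogs in the presence of padding *)

Hypothesis eps0 : (0 < eps)%R.
Hypothesis tok : traffic_ok Lmax tr.
Hypothesis M0 : 0 < M.
(** In [M] slots padding adds at most one batch per input and output and one frame per output,
    [N * (N * k + K)] bytes. The memories move [k] bytes per slot, of which the traffic needs
    [k / (1 + eps)]; the inequality says that the remaining [eps * k / (1 + eps)] per slot covers
    the padding. *)
Hypothesis M_large : ((N * (N * k + K))%:R * (1 + eps) <= eps * k%:R * M%:R)%R.

Lemma window_ind (F G : nat -> nat) (a : nat) :
  (forall n, exists2 z, z <= fl n * a & F n.+1 + G n = F n + G n.+1 + z) ->
  forall x y, x <= y -> F y + G x + a * tickM x <= F x + G y + a * tickM y.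
Proof.
move=> h x y xy; rewrite -(subnKC xy); elim: (y - x) => [|d IH]; first by rewrite addn0.
rewrite addnS tickS // -flE; have [z zl e] := h (x + d).
by rewrite mulnDr [a * nat_of_bool _]mulnC; lia.
Qed.

Lemma incount_window i j x y : x <= y ->
  incount predT i j y + acccount predT i j x + k * tickM x <=
  incount predT i j x + acccount predT i j y + k * tickM y.
Proof.
apply: (window_ind (F := incount predT i j) (G := acccount predT i j)) => n.
have [z zl e] := incountS fl new ok i j n; exists z => //.
by rewrite e acccountS /=; lia.
Qed.

Lemma inlog_window_nat i x y : x <= y ->
  k * size (inlog i y) + bytes_in i x + N * k * tickM x <=
  k * size (inlog i x) + bytes_in i y + N * k * tickM y + N * k.
Proof.
move=> xy; have /andP[h1 _] := inlog_bytes i y; have /andP[_ h2] := inlog_bytes i x.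
have := leq_sum3 (fun j => incount_window i j xy).
rewrite !sum_acccount !mulnA; lia.
Qed.

Lemma rate : (P * slot * ((1 + eps) * N%:R) = k%:R)%R.
Proof.
rewrite /slot_time; have := okP ok; have N1 : (0 < N%:R :> R)%R by rewrite ltr0n.
by move=> P0; field; rewrite !gt_eqF ?addr_gt0.
Qed.

(** Traffic at full line rate together with [a] padding bytes every [M] slots fits into the [k]
    bytes that the memories move per slot; the extra [a] is the rounding of [tickM]. *)
Lemma load_window (a x y : nat) : a <= N * (N * k + K) -> x <= y ->
  (N%:R * (P * slot * (y%:R - x%:R)) + a%:R * ((tickM y)%:R - (tickM x)%:R) <=
   k%:R * (y%:R - x%:R) + a%:R :> R)%R.
Proof.
move=> aA xy; have := tick_ub 0 M0 xy; rewrite -(ler_nat R) !natrD !natrM.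
have d0 : (0 <= y%:R - x%:R :> R)%R by rewrite subr_ge0 ler_nat.
have a0 : (0 <= a%:R :> R)%R by [].
have aM : (a%:R * (1 + eps) <= eps * k%:R * M%:R)%R.
  by apply: le_trans M_large; rewrite ler_pM2r ?addr_gt0 // ler_nat.
have M1 : (0 < M%:R :> R)%R by rewrite ltr0n.
have e1 : (0 < 1 + eps)%R by rewrite addr_gt0.
have r : (N%:R * (P * slot) * (1 + eps) = k%:R)%R by rewrite -rate; ring.
move=> tM; have k1 : (0 <= k%:R :> R)%R by [].
set d := (y%:R - x%:R)%R in d0 *; set t := ((tickM y)%:R - (tickM x)%:R)%R.
have tMd : (M%:R * t <= d + M%:R)%R by rewrite /t /d; lra.
have : (a%:R * (1 + eps) * (M%:R * t) <= a%:R * (1 + eps) * (d + M%:R))%R.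
  by apply: ler_wpM2l => //; rewrite mulr_ge0 // ltW.
have : (a%:R * (1 + eps) * d <= eps * k%:R * M%:R * d)%R by apply: ler_wpM2r.
move=> h1 h2.
rewrite -(ler_pM2r (mulr_gt0 M1 e1)).
have -> : ((N%:R * (P * slot * d) + a%:R * t) * (M%:R * (1 + eps)) =
   (N%:R * (P * slot) * (1 + eps)) * (M%:R * d) + a%:R * (1 + eps) * (M%:R * t))%R by ring.
rewrite r; lra.
Qed.

(** One [N * N * k] stems from the incomplete batches, the other from the rounding in [load_window],
    and [N * Lmax] from the packet under reception; the factor [N] is the period at which an input
    is served. *)
Definition in_burst := 2 * (N * N * k) + N * Lmax.

Lemma inlog_window i x y : x <= y ->
  N * size (inlog i y) + x <= N * size (inlog i x) + y + in_burst.
Proof.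
move=> xy; have := inlog_window_nat i xy.
have aA : N * (N * k) <= N * (N * k + K) by rewrite leq_mul2l leq_addr orbT.
have := load_window aA xy.
have := bytes_in_window ok eps0 tok i xy.
rewrite -(ler_nat R) !natrD !natrM => b_in ld sz.
have N1 : (0 <= N%:R :> R)%R by [].
have := ler_wpM2l N1 b_in; have := ler_wpM2l N1 sz.
move=> sz' b_in'; rewrite -(ler_nat R) /in_burst !natrD !natrM.
(* As [k >= 1], the burst found in bytes may be used as one in batches. *)
have k1 : (1 <= k%:R :> R)%R by rewrite ler1n.
have B0 : (0 <= 2 * (N%:R * N%:R * k%:R) + N%:R * Lmax%:R :> R)%R.
  by rewrite addr_ge0 // !mulr_ge0.
have : (2 * (N%:R * N%:R * k%:R) + N%:R * Lmax%:R <=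
        k%:R * (2 * (N%:R * N%:R * k%:R) + N%:R * Lmax%:R) :> R)%R by rewrite ler_peMl.
rewrite -(ler_pM2l (lt_le_trans ltr01 k1)).
move: sz' b_in' ld; lra.
Qed.

Definition in_backlog := in_burst + 2 * N.

Lemma loaded_backlog i n : size (inlog i n) <= loaded i n + in_backlog.
Proof.
apply: (@served_backlog N i.+1 N0 (fun n => size (inlog i n)) _ in_burst) => //.
  exact: inlog_size_mono.
by move=> x y xy; apply: inlog_window.
Qed.

Lemma tailcount_window j x y : x <= y ->
  tailcount predT j y + loadcount_to predT j x + K * tickM x <=
  tailcount predT j x + loadcount_to predT j y + K * tickM y.
Proof.
apply: (window_ind (F := tailcount predT j) (G := loadcount_to predT j)) => n.
have [z zl e] := tailcountS fl new ok j n; exists z => //.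
by rewrite e /loadcount_to sum_loaded //=; lia.
Qed.

Lemma incount_le j n : \sum_(i < N) incount predT i j n <=
  loadcount_to predT j n + N * (k * in_backlog + k).
Proof.
rewrite /loadcount_to -[X in _ <= _ + X * _]card_ord -sum_nat_const -big_split /=.
apply: leq_sum => i _; rewrite /incount.
have [qk lk] := inq_ok fl new ok i n; rewrite -/(inlog i n) in lk.
rewrite -{1}(cat_take_drop (loaded i n) (inlog i n)) bcount_cat -addnA leq_add2l.
apply: leq_add; last by rewrite count_predT ltnW.
rewrite -{1}(cat_take_drop (loaded i n) (inlog i n)) all_cat in lk.
case/andP: lk => _ /bcountT_le /leq_trans; apply; rewrite leq_mul2l size_drop.
by rewrite leq_subLR loaded_backlog orbT.
Qed.

(** The bytes for one output that can already be in the switch without being in a frame: an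
    incomplete frame, and at each input the waiting batches and an incomplete one. *)
Definition frame_burst := K + N * (k * in_backlog + k).

Lemma fcount_window j x y : x <= y ->
  fcount predT j (flog y) + bytes_to j x + (N * k + K) * tickM x <=
  fcount predT j (flog x) + bytes_to j y + (N * k + K) * tickM y + frame_burst.
Proof.
move=> xy; have h1 := tailcount_window j xy.
have h2 := loadcount_le predT j y; have h3 := incount_le j x.
have h4 := tailq_bytes j x.
have := leq_sum3 (fun i => incount_window i j xy).
have accE n : \sum_(i < N) acccount predT i j n = bytes_to j n.
  by apply: eq_bigr => i _; rewrite acccountT.
move: h1; rewrite !accE /tailcount /frame_burst !mulnDl !mulnA; lia.
Qed.

Definition flog_burst := N * Lmax + N * (N * k + K) + N * frame_burst.

Lemma flog_window x y : x <= y ->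
  W * size (flog y) + x <= W * size (flog x) + y + flog_burst.
Proof.
move=> xy; have h : K * size (flog y) + \sum_(i < N) bytes_in i x +
     N * (N * k + K) * tickM x <= K * size (flog x) + \sum_(i < N) bytes_in i y +
     N * (N * k + K) * tickM y + N * frame_burst.
  have := leq_sum3 (fun j => leq_trans (fcount_window j xy) (eq_leq (esym (addnA _ _ _)))).
  have fE n : \sum_(j < N) fcount predT j (flog n) = K * size (flog n).
    under eq_bigr do rewrite fcountT ?flog_ok //.
    by rewrite -big_distrr /= sum_frames_of.
  by rewrite !sum_bytes_to !fE mulnDr !mulnA !addnA.
have aA : N * (N * k + K) <= N * (N * k + K) by [].
have := load_window aA xy; have := bytes_window ok eps0 tok xy.
move: h; rewrite -(ler_nat R) -[X in X * size (flog y)]WkK -[X in X * size (flog x)]WkK.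
rewrite !(natrD, natrM) => h b_in ld.
have k1 : (1 <= k%:R :> R)%R by rewrite ler1n.
have C0 : (0 <= flog_burst%:R :> R)%R by [].
have : (flog_burst%:R <= k%:R * flog_burst%:R :> R)%R by rewrite ler_peMl.
rewrite -(ler_nat R) -(ler_pM2l (lt_le_trans ltr01 k1)) !(natrD, natrM).
move: h b_in ld; lra.
Qed.

Definition pop_backlog := flog_burst + 2 * W.

Lemma popped_backlog n : size (flog (n - N)) <= popped n + pop_backlog.
Proof.
apply: (@served_backlog W 0 W0 (fun n => size (flog (n - N))) _ flog_burst).
- exact: flogB_size_mono.
  by rewrite sub0n.
move=> x y xy; have := flog_window (leq_sub2r N xy).
have : x + (y - N) <= y + (x - N) by lia.
by lia.
Qed.

(** Completing a write takes up to [W] slots and the skew of the tail modules [N]. During these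
    slots the log gains at most [W + N + flog_burst] frames, and [pop_backlog] may have been waiting
    before. *)
Lemma flog_written n : size (flog n) <= written n + (W + N + flog_burst + pop_backlog).
Proof.
have h1 : popped (n - W) <= written n.
  have [nW|Wn] := leqP W n; last by have -> : n - W = 0 by lia.
  rewrite -{2}(subnK nW); apply: latch_lb => //; exact: popped_mono.
have h2 := popped_backlog (n - W).
have le : n - W - N <= n by lia.
have h3 := flog_window le.
have h4 : W * (size (flog n) - size (flog (n - W - N))) <= W * (W + N + flog_burst).
  apply: (@leq_trans (W + N + flog_burst)); last by rewrite leq_pmull.
  by rewrite mulnBr; lia.
rewrite leq_pmul2l // in h4; lia.
Qed.

Definition hbm_burst := frame_burst + K * (W + N + flog_burst + pop_backlog).

Lemma hbmq_window j x y : x <= y ->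
  K * size (hbmq j y) + bytes_to j x + (N * k + K) * tickM x <=
  K * size (hbmq j x) + bytes_to j y + (N * k + K) * tickM y + hbm_burst.
Proof.
move=> xy; have := fcount_window j xy; rewrite !fcountT ?flog_ok //.
have h1 : K * size (hbmq j y) <= K * size (frames_of j (flog y)).
  rewrite leq_mul2l; apply/orP; right.
  rewrite -[X in frames_of j X](cat_take_drop (written y) (flog y)) frames_of_cat size_cat; exact: leq_addr.
have h2 : K * size (frames_of j (flog x)) <=
    K * size (hbmq j x) + K * (W + N + flog_burst + pop_backlog).
  rewrite -mulnDr leq_mul2l; apply/orP; right.
  rewrite -[X in frames_of j X](cat_take_drop (written x) (flog x)) frames_of_cat size_cat leq_add2l.
  rewrite size_map size_filter (leq_trans (count_size _ _)) // size_drop leq_subLR.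
  exact: flog_written.
rewrite /hbm_burst; lia.
Qed.

(** The summands are the wait for the padding of a batch, the draining of the input queue, the wait
    for the padding of a frame, the skew of the tail modules, the draining of the tail SRAM and the
    window of the write. *)
Definition hbm_delay := M + N * in_backlog + M + N + W * pop_backlog + W.

Lemma fcount_written Q i j s : Q None = false ->
  acccount Q i j s <= fcount Q j (take (written (s + hbm_delay)) (flog (s + hbm_delay))).
Proof.
move=> Q0; rewrite -incount_acc //.
have [d1 d1M p1] := periodic_next 0 M0 s; rewrite -flE in p1.
have in1 : incount Q i j s <= bcount Q j (inlog i (s + M)).
  apply: (@leq_trans (bcount Q j (inlog i (s + d1).+1))); last by apply: bcount_mono; lia.
  have -> : bcount Q j (inlog i (s + d1).+1) = incount Q i j (s + d1).+1.
    by rewrite /incount flush_inq // addn0.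
  rewrite !incount_acc //.
  have : s <= (s + d1).+1 by lia.
  elim: (s + d1).+1 => [|n IH]; first by rewrite leqn0 => /eqP ->.
  rewrite leq_eqVlt => /orP[/eqP -> //|sn]; apply: leq_trans (IH sn) _.
  by rewrite acccountS leq_addr.
set n1 := s + M in in1; set n2 := n1 + N * in_backlog.
have in2 : bcount Q j (inlog i n1) <= tailcount Q j n2.
  rewrite tailcount_load // /loadcount_to (bigD1 i) //=.
  apply: leq_trans (leq_addr _ _).
  have ld : size (inlog i n1) <= loaded i n2.
    apply: (@served_drain N i.+1 N0 (fun n => size (inlog i n))).
      exact: inlog_size_mono.
    exact: loaded_backlog.
  have [t ->] : exists t, inlog i n2 = inlog i n1 ++ t.
    by apply: inlog_prefix; rewrite leq_addr.
  by rewrite take_cat ltnNge ld /= bcount_le_cat.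
have [d2 d2M p2] := periodic_next 0 M0 n2; rewrite -flE in p2.
set n3 := n2 + M.
have in3 : tailcount Q j n2 <= fcount Q j (flog n3).
  apply: (@leq_trans (fcount Q j (flog (n2 + d2).+1))); last by apply: fcount_mono; lia.
  have -> : fcount Q j (flog (n2 + d2).+1) = tailcount Q j (n2 + d2).+1.
    by rewrite /tailcount flush_tailq //= addn0.
  rewrite !tailcount_load //.
  have : n2 <= (n2 + d2).+1 by lia.
  elim: (n2 + d2).+1 => [|n IH]; first by rewrite leqn0 => /eqP ->.
  rewrite leq_eqVlt => /orP[/eqP -> //|sn]; apply: leq_trans (IH sn) _.
  by rewrite /loadcount_to sum_loaded // leq_addr.
set n4 := n3 + N + W * pop_backlog.
have in4 : size (flog n3) <= popped n4.
  rewrite -[X in flog X](addnK N).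
  apply: (@served_drain W 0 W0 (fun n => size (flog (n - N)))).
    exact: flogB_size_mono.
  exact: popped_backlog.
have -> : s + hbm_delay = n4 + W.
  by rewrite /hbm_delay /n4 /n3 /n2 /n1 !addnA.
have in5 : popped n4 <= written (n4 + W).
  by apply: latch_lb => //; exact: popped_mono.
apply: leq_trans in1 (leq_trans in2 (leq_trans in3 _)).
have [t ->] : exists t, flog (n4 + W) = flog n3 ++ t.
  by apply: flog_prefix; rewrite /n4; lia.
rewrite take_cat ltnNge (leq_trans in4 in5) /= fcount_cat leq_addr //.
Qed.

End Delay.


(** * Comparison of the two switches *)

Section Mimic.
Local Open Scope nat_scope.
Variables (R : realType) (c : config R) (eps : R) (M Lmax : nat) (tr : traffic c).
Local Notation N := (cN c).
Local Notation k := (ck c).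
Local Notation K := (cK c).
Local Notation W := (cK c %/ ck c).
Local Notation P := (cP c).
Local Notation slot := (slot_time c eps).
Local Notation new := (new_packets eps tr).
Local Notation fl := (dvdn M).
Local Notation st n := (run eps (periodic_policy c M) tr n).
Local Notation inlog := (inlog fl new).
Local Notation loaded := (loaded fl new).
Local Notation flog := (flog fl new).
Local Notation written := (written fl new).
Local Notation hbmq := (hbmq fl new).
Local Notation reads := (reads fl new).
Local Notation delivered := (delivered fl new).
Local Notation headlog := (headlog fl new).
Local Notation started := (started fl new).
Local Notation incount := (incount fl new).
Local Notation accepted := (accepted eps tr).
Local Notation bytes_to := (bytes_to eps tr).
Local Notation acccount := (@acccount R c eps tr).
Local Notation horizon := (@horizon R c eps).
Local Notation tickM := (tick M 0).
Local Notation completed := (@completed R c eps M tr).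
Local Notation received := (@received R c eps M tr).
Local Notation hbm_delay := (@hbm_delay R c M Lmax).
Local Notation hbm_burst := (@hbm_burst R c Lmax).
Local Notation head_backlog := (@head_backlog R c).

Hypothesis ok : config_ok c.
Hypothesis eps0 : (0 < eps)%R.
Hypothesis tok : traffic_ok Lmax tr.
Hypothesis M0 : 0 < M.
Hypothesis M_large : ((N * (N * k + K))%:R * (1 + eps) <= eps * k%:R * M%:R)%R.
Let N0 : 0 < N := okN ok.
Let k0 : 0 < k := okk ok.
Let K0 : 0 < K := okK ok.
Let WkK : W * k = K. Proof. by rewrite divnK // okkK. Qed.
Let W0 : 0 < W. Proof. by rewrite divn_gt0 // dvdn_leq // okkK. Qed.
Let NW0 : 0 < N * W. Proof. by rewrite muln_gt0 N0. Qed.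

Lemma count_cells (p q : packet N) b :
  count (pred1 (Some (p, b))) (cells_of q : seq (cell c)) = (q == p) && (b < len p).
Proof.
rewrite count_map; have [->|qp] := eqVneq q p; last first.
  rewrite (eq_count (a2 := pred0)) ?count_pred0 // => b' /=.
  by apply/negbTE/eqP => -[e _]; rewrite e eqxx in qp.
rewrite (eq_count (a2 := pred1 b)) => [|b' /=].
  by rewrite (count_uniq_mem _ (iota_uniq _ _)) mem_iota.
by apply/eqP/eqP => [[]|->].
Qed.

Lemma acccount_cell p b i j n : acccount (pred1 (Some (p, b))) i j n =
  [&& p \in accepted i n, dst p == j & b < len p].
Proof.
rewrite /acccount big_mkcond /=.
have z q : q != p -> (if dst q == j
    then count (pred1 (Some (p, b))) (cells_of q : seq (cell c)) else 0) = 0.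
  by move=> /negbTE qp; case: ifP; rewrite ?count_cells ?qp.
have [pin|pnin] := boolP (p \in accepted i n); last first.
  rewrite big_seq big1 // => q qin; apply: z; apply: contraNneq pnin => <- //.
rewrite (bigD1_seq p) ?(accepted_uniq ok eps0 tok) //= big1 => [|q qp]; last exact: z.
by rewrite addn0 count_cells eqxx; case: eqP.
Qed.

Lemma sum_acccount_cell p b j n : \sum_(i < N) acccount (pred1 (Some (p, b))) i j n =
  [&& p \in accepted (src p) n, dst p == j & b < len p].
Proof.
rewrite (bigD1 (src p)) //= acccount_cell big1 ?addn0 // => i isrc.
rewrite acccount_cell; case pin: (_ \in _) => //.
by move: isrc; rewrite (accepted_src ok eps0 tok pin) eqxx.
Qed.

Lemma fcount_flatten Q j (l : seq (tframe c)) :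
  fcount Q j l = count Q (flatten (flatten (frames_of j l))).
Proof.
elim: l => [|f l IH]; first by rewrite /fcount big_nil.
rewrite /fcount big_cons /frames_of /= -/(fcount Q j l) IH.
by case: eqP => //= _; rewrite flatten_cat count_cat.
Qed.

(** No stage holds a byte more often than the inputs have accepted it, which is at most once because
    the packets of an input are distinct. *)
Lemma count_hbmq (p : packet N) b j n :
  count (pred1 (Some (p, b))) (flatten (flatten (hbmq j n))) <=
  [&& p \in accepted (src p) n, dst p == j & b < len p].
Proof.
rewrite -sum_acccount_cell -fcount_flatten; set Q := pred1 _.
have Q0 : Q None = false by [].
have -> : \sum_(i < N) acccount Q i j n = \sum_(i < N) incount Q i j n.
  by apply: eq_bigr => i _; rewrite incount_acc.
apply: leq_trans (loadcount_le eps M tr Q j n); rewrite -(tailcount_load eps M tr ok j n Q0).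
apply: (@leq_trans (fcount Q j (flog n))); last exact: leq_addr.
by rewrite -[X in _ <= fcount Q j X](cat_take_drop (written n)) fcount_cat leq_addr.
Qed.

Lemma count_flatten_take T (Q : pred T) a (l : seq (seq T)) :
  count Q (flatten (take a l)) <= count Q (flatten l).
Proof. by rewrite -[X in _ <= count _ (flatten X)](cat_take_drop a) flatten_cat count_cat leq_addr. Qed.

Lemma count_pmap_id (T : eqType) (v : T) (s : seq (option T)) :
  count_mem v (pmap id s) = count_mem (Some v) s.
Proof. by elim: s => //= -[u|] s IH /=; rewrite IH. Qed.

Lemma count_received (p : packet N) b j n : count_mem (p, b) (received j n) <=
  [&& p \in accepted (src p) n, dst p == j & b < len p].
Proof.
apply: leq_trans (count_hbmq p b j n); rewrite count_pmap_id.
apply: leq_trans (count_flatten_take _ _ _) _; rewrite /headlog.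
rewrite -[X in _ <= count _ (flatten (flatten X))](cat_take_drop (delivered j n)).
by rewrite !flatten_cat count_cat leq_addr.
Qed.

Lemma received_ok j n : cells_ok (received j n).
Proof.
split=> [|[p b]].
  apply: count_mem_uniq => -[p b]; apply/eqP; rewrite eqn_leq.
  rewrite -has_pred1 has_count.
  have := count_received p b j n; case: (count_mem _ _) => [|[|m]] //.
  by case: [&& _, _ & _].
rewrite -has_pred1 has_count => h; have := leq_trans h (count_received p b j n).
by case: and3P => // -[].
Qed.

(** Within [N] slots the output faces the first head module again, and by then every batch started
    earlier has been received in full. *)
Lemma completed_started j n : started j n <= completed j (n + N).
Proof.
have [d dN pd] := periodic_next j N0 n.
apply: (@leq_trans (completed j (n + d))); last by apply: completed_mono => //; lia.
have p0 : phase j (n + d) = 0 by apply/eqP; rewrite /phase addnC.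
rewrite /completed; have [+ _ _] := outP eps M tr ok j (n + d); rewrite p0.
case: (op_on _) => [/(_ isT)[]|] // _; rewrite subn0.
by apply: served_mono; lia.
Qed.

Lemma completed_hits j n h : h <= completed j n -> exists2 m, m <= n & completed j m = h.
Proof.
elim: n => [|n IH] hn.
  by exists 0 => //; apply/eqP; rewrite eqn_leq hn andbT.
have [/IH[m mn e]|lt] := leqP h (completed j n); first by exists m => //; lia.
exists n.+1 => //; apply/eqP; rewrite eqn_leq hn andbT.
by apply: leq_trans lt; apply: completed_step.
Qed.

Lemma take_flatten_all T (s a : nat) (l : seq (seq T)) :
  all (fun v => size v == s) l -> take (a * s) (flatten l) = flatten (take a l).
Proof.
elim: l a => [|v l IH] [|a] //=; first by rewrite take0.
move=> /andP[/eqP vs ls]; rewrite mulSn takeD -vs take_size_cat // drop_size_cat //.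
by rewrite vs IH.
Qed.

Lemma received_hbmq j x n : completed j n = W * size (hbmq j x) ->
  received j n = pmap id (flatten (flatten (hbmq j x))).
Proof.
move=> e; rewrite /received e; congr (pmap id (flatten _)).
have ch : W * size (hbmq j x) <= W * delivered j n.
  rewrite -e; apply: leq_trans (completed_le _ _ _ ok _ _) _.
  by rewrite size_headlog.
rewrite leq_pmul2l // in ch.
have allW : all (fun v => size v == W) (take (delivered j n) (hbmq j n)).
  apply/allP => bs /mem_take bn.
  by have /andP[] := hbmq_batches_ok ok bn.
rewrite /headlog mulnC take_flatten_all // take_takel //; congr flatten.
have dl := delivered_le fl new ok j n.
have [nx|/ltnW xn] := leqP n x.
  have [s es] := hbmq_prefix fl new ok j nx.
  move: ch; rewrite es size_cat => ch; have : size s = 0 by lia.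
  by case: (s) => // _; rewrite /= ?addn0 cats0 take_size.
have [s ->] := hbmq_prefix fl new ok j xn.
by rewrite take_size_cat.
Qed.

Lemma all_received a j x : dst (a : packet N) = j ->
  forall s, s + hbm_delay <= x -> a \in accepted (src a) s ->
  all (fun b => (a, b) \in pmap id (flatten (flatten (hbmq j x)))) (iota 0 (len a)).
Proof.
move=> aj s sx ain; apply/allP => b; rewrite mem_iota add0n => /andP[_ bl].
rewrite -has_pred1 has_count count_pmap_id -fcount_flatten.
have Q0 : (pred1 (Some (a, b)) : pred (cell c)) None = false by [].
have h := fcount_written ok eps0 tok M0 M_large (src a) j s Q0.
rewrite acccount_cell ain aj eqxx bl /= in h.
apply: leq_trans h _; rewrite !fcount_flatten.
have [t et] := hbmq_prefix fl new ok j sx.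
by rewrite -!/(hbmq _ _) et !flatten_cat count_cat leq_addr.
Qed.

Local Open Scope ring_scope.

(** The time per byte when an output is read [K] bytes every [N * W] slots, that is
    [1 / ((1 + eps) * P)]. *)
Definition byte_time : R := slot * N%:R / k%:R.
Definition late_bytes : R := N%:R * (P * slot * (hbm_delay.+1)%:R + Lmax%:R).
(** [W + N * head_backlog + N] slots lead from the read turn to the output port; [2 * (N * W)] and
    [M] are the roundings of the read and padding schedules. The HBM may have to read
    [late_bytes + hbm_burst] bytes more than those accepted between [x0] and [s]. The summand
    [2 * hbm_delay + 3] is dictated by the case in which [x0] is later than [s]. *)
Definition exit_delay : R :=
  slot * (2 * hbm_delay + 3 + 2 * (N * W) + M + (W + N * head_backlog + N))%:R +
  byte_time * (late_bytes + hbm_burst%:R).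

(** [x0] is the last slot at which the HBM had no frame for the output, and [h0] the
    frames written by then; [bx0], [bs] and [bx] are the bytes accepted for the output
    before the slots [x0], [s] and [x]. *)
Lemma exit_arith (x0 s x y tx0 tx : nat) (h0 h bx0 bs bx e : R) :
  x = (s.+1 + hbm_delay)%N -> (x0 <= x)%N ->
  y%:R + (N * W)%:R * h0 <= x0%:R + (N * W)%:R * h + 2 * (N * W)%:R ->
  K%:R * h + bx0 + (N * k + K)%:R * tx0%:R <=
    K%:R * h0 + bx + (N * k + K)%:R * tx%:R + hbm_burst%:R ->
  M%:R * tx%:R + x0%:R <= M%:R * tx0%:R + x%:R + M%:R :> R -> (tx0 <= tx)%N ->
  bx <= bs + late_bytes -> horizon s <= e ->
  ((x0 <= s)%N -> horizon x0 + (bs - bx0) / P <= e) -> ((s <= x0)%N -> bs <= bx0) ->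
  slot * (y + (W + N * head_backlog + N))%:R <= e + exit_delay.
Proof.
move=> xE x0x hy hK hM tt hb hs hx hx'.
have sl0 := slot_gt0 ok eps0; have P0 := okP ok.
have N1 : 0 < N%:R :> R by rewrite ltr0n.
have k1 : 0 < k%:R :> R by rewrite ltr0n.
have M1 : 0 < M%:R :> R by rewrite ltr0n.
have e1 : 0 < 1 + eps by rewrite addr_gt0.
have bt0 : 0 < byte_time by rewrite /byte_time !(divr_gt0, mulr_gt0).
have btP : byte_time * P * (1 + eps) = 1.
  have := rate ok eps0; rewrite /byte_time => r.
  by apply: (mulIf (lt0r_neq0 k1)); rewrite mul1r -[RHS]r; field; rewrite gt_eqF.
have btK : byte_time * K%:R = slot * (N * W)%:R.
  have -> : K%:R = W%:R * k%:R :> R by rewrite -natrM WkK.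
  by rewrite /byte_time natrM; field; rewrite gt_eqF.
set A := (N * k + K)%:R in hK.
have A0 : 0 <= A by [].
have btA : byte_time * A * (1 + eps) <= eps * slot * M%:R.
  have -> : byte_time * A * (1 + eps) = slot / k%:R * ((N * (N * k + K))%:R * (1 + eps)).
    by rewrite natrM /byte_time -/A; field; rewrite gt_eqF.
  have -> : eps * slot * M%:R = slot / k%:R * (eps * k%:R * M%:R).
    by field; rewrite gt_eqF.
  by rewrite ler_pM2l // divr_gt0.
(* Of the read rate of an output, a share [th] pays for padding, and the rest is
   the line rate [P]. *)
pose th := eps / (1 + eps).
have th0 : 0 < th by rewrite divr_gt0.
have th1 : 1 - th = byte_time * P.
  apply: (mulIf (lt0r_neq0 e1)); rewrite btP /th; field; by rewrite gt_eqF.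
have thle : th <= 1 by rewrite ler_pdivrMr // mul1r lerDr.
pose t : R := tx%:R - tx0%:R.
have t0 : 0 <= t by rewrite subr_ge0 ler_nat.
have btAt : byte_time * A * t <= th * slot * (x%:R - x0%:R + M%:R).
  have -> : th * slot * (x%:R - x0%:R + M%:R) =
      eps * slot * (x%:R - x0%:R + M%:R) / (1 + eps) by rewrite /th; field; rewrite gt_eqF.
  rewrite ler_pdivlMr // mulrAC.
  apply: (@le_trans _ _ (eps * slot * M%:R * t)); first by apply: ler_wpM2r.
  rewrite -mulrA ler_pM2l ?(mulr_gt0 eps0 sl0) // /t; lra.
have yK : slot * y%:R <= slot * x0%:R + slot * (2 * (N * W)%:R) + byte_time * (K%:R * h - K%:R * h0).
  have -> : byte_time * (K%:R * h - K%:R * h0) = byte_time * K%:R * (h - h0) by ring.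
  rewrite btK; have := ler_wpM2l (ltW sl0) hy; lra.
have Kb : byte_time * (K%:R * h - K%:R * h0) <=
    byte_time * (bx - bx0 + A * t + hbm_burst%:R).
  by rewrite ler_pM2l // /t; lra.
have ex : x%:R = s%:R + 1 + hbm_delay%:R :> R by rewrite xE natrD -natr1.
have hor n : horizon n = slot * n%:R - slot by rewrite /horizon; ring.
have xx : (x0%:R <= x%:R :> R) by rewrite ler_nat.
have D0 : 0 <= hbm_delay%:R :> R by [].
have sD : 0 <= slot * hbm_delay%:R by rewrite mulr_ge0 // ltW.
have thM : th * slot * M%:R <= slot * M%:R.
  by rewrite ler_pM2r // ler_piMl // ltW.
set Y := (W + N * head_backlog + N)%N; rewrite /exit_delay -/Y.
have natE (p q m z : nat) : (2 * p + 3 + 2 * q + m + z)%:R =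
    2 * p%:R + 3 + 2 * q%:R + m%:R + z%:R :> R by rewrite 4!natrD 2!natrM.
rewrite natE natrD.
have btb : byte_time * (bx - bx0) <= byte_time * late_bytes + byte_time * (bs - bx0).
  by rewrite -mulrDr ler_pM2l //; lra.
have thd u v : u <= v -> th * slot * u <= th * slot * v.
  by move=> uv; rewrite ler_pM2l // mulr_gt0.
have thD : th * slot * (1 + hbm_delay%:R) <= slot * (1 + hbm_delay%:R).
  by rewrite ler_wpM2r ?addr_ge0 // ler_piMl // ltW.
(* For [x0 <= s] the time elapsed in the output-queued switch since [x0] pays both for the bytes,
   with share [1 - th], and for the padding, with share [th]. Otherwise no bytes have to be
   compared, and [x0] is at most [hbm_delay + 1] slots after [s]. *)
have [x0s|/ltnW sx0] := leqP x0 s.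
  have := hx x0s; set E := e - horizon x0 => hE.
  have E1 : byte_time * (bs - bx0) <= (1 - th) * E.
    have -> : byte_time * (bs - bx0) = (1 - th) * ((bs - bx0) / P).
      by rewrite th1; field; rewrite gt_eqF.
    by rewrite ler_wpM2l ?subr_ge0 // /E; lra.
  have E2 : th * slot * (s%:R - x0%:R) <= th * E.
    rewrite -mulrA ler_pM2l // /E; move: hs; rewrite !hor; lra.
  have eE : E = e - (slot * x0%:R - slot) by rewrite /E hor.
  move: yK Kb btAt btb thM thD E1 E2; rewrite ex eE; lra.
have b0 : byte_time * (bs - bx0) <= 0.
  by rewrite pmulr_rle0 // subr_le0 hx'.
have := thd _ _ (_ : x%:R - x0%:R <= 1 + hbm_delay%:R).
have sx : s%:R <= x0%:R :> R by rewrite ler_nat.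
rewrite ex => /(_ ltac:(lra)) thx.
have sx0' : slot * x0%:R <= slot * (s%:R + 1 + hbm_delay%:R).
  by rewrite ler_pM2l // -ex ler_nat.
move: yK Kb btAt btb thM thD hs; rewrite ex hor; lra.
Qed.

Lemma slot_of (t : R) : 0 < t -> exists s, horizon s < t <= horizon s.+1.
Proof.
move=> t0; have sl0 := slot_gt0 ok eps0.
have ex : exists n, t <= horizon n.
  exists (Num.truncn (t / slot)).+2; rewrite horizonS -ler_pdivrMr //.
  exact/ltW/truncnS_gt.
case: (ex_minnP ex) => -[|s] hs mins; last first.
  by exists s; rewrite hs andbT ltNge; apply/negP => /mins; rewrite ltnn.
by move: hs; rewrite /horizon sub0r mulN1r => /(lt_le_trans t0); rewrite oppr_gt0 ltNge (ltW sl0).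
Qed.

(** Besides the time bound, the slot [n] is such that nothing sent by then was accepted after slot
    [s.+1 + hbm_delay]. This caps the bytes by which later packets can have overtaken [a]. *)
Lemma exit_slot a : is_arrival tr a -> exists s n,
  [/\ horizon s < a.1, a.1 <= horizon s.+1,
      a.2 \in unzip1 (op_sent (st_out (st n) (dst a.2))),
      forall q, q \in unzip1 (op_sent (st_out (st n) (dst a.2))) ->
        q \in accepted (src q) (s.+1 + hbm_delay) /\ dst q = dst a.2
    & slot * n%:R <= oq_exit tr a + exit_delay].
Proof.
move=> aA; have [i [m am]] := aA; set j := dst a.2.
have sl0 := slot_gt0 ok eps0.
have [s /andP[sa as1]] := slot_of (arrival_gt0 ok tok am).
have asrc : src a.2 = i by have [] := tr_id tok am.
have ain : a.2 \in accepted (src a.2) s.+1.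
  by apply/(acceptedP ok eps0 tok); exists a => //; exists m; rewrite ?asrc.
have [x xE] : {x | x = (s.+1 + hbm_delay)%N} by eexists.
pose h n := size (hbmq j n).
have h_mono : forall y z, (y <= z)%N -> (h y <= h z)%N by move=> y z; exact: hbmq_size_mono.
pose r := ((N - j) * W)%N.
have h00 : h 0%N = 0%N by rewrite /h /hbmq /= .
have [x0 x0x [rx0 rt]] := served_last_empty r NW0 h_mono x h00.
rewrite -/(reads j x0) -/(reads j x) in rx0 rt.
have rh := reads_le fl new ok j x; rewrite -/(h x) in rh.
(* Each frame still to be read takes one turn, which comes every [N * W] slots. *)
pose y := (x + N * W * (h x - reads j x))%N.
have ry : (h x <= reads j y)%N by apply: served_drain => //; rewrite subnKC.
pose n := (y + (W + N * head_backlog + N))%N.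
have cn : (W * h x <= completed j n)%N.
  have -> : n = (y + W + N * head_backlog + N)%N by rewrite /n !addnA.
  apply: leq_trans (completed_started j _).
  have dy : (h x <= delivered j (y + W))%N.
    by apply: leq_trans ry _; apply: latch_lb => //; exact: reads_mono.
  apply: (@leq_trans (size (headlog j (y + W)%N))).
    by rewrite size_headlog // leq_mul2l dy orbT.
  apply: (@served_drain N j N0 (fun n => size (headlog j n))).
    exact: headlog_size_mono.
  exact: started_backlog.
(* At [n'] the port has received exactly the frames written by slot [x]: enough to contain [a], and
   nothing accepted later. *)
have [n' n'n cn'] := completed_hits cn.
have rE := received_hbmq cn'.
have [_ sentE _] := out_port_ok ok (received_ok j) n'.
exists s, n'; split=> //.
- rewrite sentE rE (all_received (s := s.+1) erefl) ?xE // andbT.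
  by have /andP[] := tr_len tok am.
- move=> q; rewrite sentE => /andP[q0 /allP /(_ 0%N)].
  rewrite mem_iota add0n q0 rE => /(_ isT) qin; rewrite -xE.
  have : (0 < count_mem (q, 0%N) (pmap id (flatten (flatten (hbmq j x)))))%N.
    by rewrite -has_count has_pred1.
  rewrite count_pmap_id => /leq_trans /(_ (count_hbmq q 0 j x)).
  by case: and3P => // -[qx /eqP].
apply: (@le_trans _ _ (slot * n%:R)); first by rewrite ler_pM2l // ler_nat.
have hor_le := horizon_le ok eps0.
have tl := tick_lb r NW0 x0x.
have hw := hbmq_window ok eps0 tok M0 M_large j x0x.
have tu := tick_ub 0 M0 x0x.
have sx : (s <= x)%N by rewrite xE; lia.
apply: (@exit_arith x0 s x y (tickM x0) (tickM x) (h x0)%:R (h x)%:R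
  (bytes_to j x0)%:R (bytes_to j s)%:R (bytes_to j x)%:R) => //.
- rewrite -!natrM -!natrD ler_nat /y.
  have : (N * W * (reads j x0 + tick (N * W) r x) <=
          N * W * (reads j x + tick (N * W) r x0 + 1))%N by rewrite leq_mul2l rt orbT.
  rewrite !mulnDr rx0 mulnBr -/(h x0).
  have : (N * W * reads j x <= N * W * h x)%N by rewrite leq_mul2l rh orbT.
  move: tl; lia.
- by rewrite -!natrM -!natrD ler_nat.
- by rewrite -!natrM -!natrD ler_nat.
- exact: tick_mono.
- apply: le_trans (bytes_to_window ok eps0 tok j sx) _; rewrite lerD2l /late_bytes.
  by rewrite xE addSnnS natrD addrAC subrr add0r.
- exact: le_trans (ltW sa) (oq_exit_ge ok tok aA).
- move=> x0s; exact: (oq_exit_bytes ok eps0 tok aA x0s sa).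
- by move=> sx0; rewrite ler_nat; apply: bytes_to_mono.
Qed.

Lemma sum_after_horizon (S : seq (arrival c)) j s x : (s <= x)%N -> uniq S ->
  (forall b, b \in S -> [/\ is_arrival tr b, horizon s < b.1, b.1 <= horizon x & dst b.2 = j]) ->
  (\sum_(b <- S) len b.2)%:R <= N%:R * (P * slot * (x%:R - s%:R) + Lmax%:R) :> R.
Proof.
move=> sx uS SP; have := bytes_to_window ok eps0 tok j sx.
suff : (\sum_(b <- S) len b.2 + bytes_to j s <= bytes_to j x)%N.
  by rewrite -(ler_nat R) natrD; lra.
rewrite !(bytes_toE ok eps0 tok) -[X in (_ + X <= _)%N]big_filter -[X in (_ <= X)%N]big_filter.
rewrite -big_cat; apply: leq_sum_sub.
  rewrite cat_uniq uS filter_uniq ?(arrivals_uniq ok tok) // andbT.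
  apply/hasPn => b; rewrite mem_filter => /andP[_ /(arrivalsP ok tok)[i [n [_ bs]]]].
  by apply/negP => /SP[_ sb _ _]; move: sb; rewrite ltNge bs.
move=> b; rewrite mem_cat !mem_filter => /orP[/SP[[i [n bn]] _ bx ->]|].
  by rewrite eqxx; apply/(arrivalsP ok tok); exists i, n.
move=> /andP[-> /(arrivalsP ok tok)[i [n [bn bs]]]].
apply/(arrivalsP ok tok); exists i, n; split=> //.
exact: le_trans bs (horizon_le ok eps0 sx).
Qed.

(** [slot] is due to the busy period being dated from the end of slot [n0], [exit_delay] to the
    packets of that period, [Lmax] to the one among them that leaves the output-queued switch first,
    and [late_bytes] to those that come after [a] in FIFO order. *)
Definition mimic_delay : R := slot + exit_delay + Lmax%:R / P + late_bytes / P.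

Lemma exits_in_time a : is_arrival tr a ->
  exists2 d, hbm_exits eps (periodic_policy c M) tr a.2 d &
    d <= oq_exit tr a + mimic_delay.
Proof.
move=> aA; have P0 := okP ok; have sl0 := slot_gt0 ok eps0; set j := dst a.2.
have [s [n [sa as1 aout outin an]]] := exit_slot aA.
rewrite -/j in aout outin.
case/mapP: aout => -[p d] pd /= ap; rewrite -{}ap in pd.
have [x xE] : {x | x = (s.+1 + hbm_delay)%N} by eexists.
have sx : (s <= x)%N by rewrite xE; lia.
have [_ /(_ _ _ pd)[n0 [s' [s2 [s3 [sentE dE]]]]]] := line_okP M tr ok j n eps0.
exists d; first by exists n.
have [_ _ usent] := out_port_ok ok (received_ok j) n.
set s2' := rcons s2 _ in sentE dE.
have s2in q : q \in unzip1 s2' -> q \in unzip1 (op_sent (st_out (st n) j)).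
  by rewrite sentE /unzip1 !map_cat !mem_cat => ->; rewrite !orbT.
have s2late q : q \in unzip1 s2' -> q \notin unzip1 (op_sent (st_out (st n0) j)).
  move=> qs; move: usent; rewrite sentE /unzip1 !map_cat cat_uniq => /and3P[_ /hasPn h _].
  by apply: h; rewrite !mem_cat qs orbT.
have us2 : uniq (unzip1 s2').
  move: usent; rewrite sentE /unzip1 !map_cat cat_uniq => /and3P[_ _].
  by rewrite !cat_uniq => /and3P[_ _ /and3P[]].
pose S := [seq b <- arrivals tr (horizon x) | b.2 \in unzip1 s2'].
have uS : uniq S by rewrite filter_uniq ?(arrivals_uniq ok tok).
have SP b : b \in S -> [/\ is_arrival tr b, b.1 <= horizon x, b.2 \in unzip1 s2' & dst b.2 = j].
  rewrite mem_filter => /andP[bs /(arrivalsP ok tok)[i [m [bm bx]]]].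
  by split=> //; [exists i, m|have [_] := outin _ (s2in _ bs)].
have sumS : (\sum_(q <- s2') len q.1 <= \sum_(b <- S) len b.2)%N.
  have -> : (\sum_(q <- s2') len q.1 = \sum_(q <- unzip1 s2') len q)%N by rewrite big_map.
  have -> : (\sum_(b <- S) len b.2 = \sum_(q <- [seq b.2 | b <- S]) len q)%N by rewrite big_map.
  apply: leq_sum_sub => // q qs; have [qx qd] := outin _ (s2in _ qs).
  case/(acceptedP ok eps0 tok): qx => b bq [m bm bh].
  apply/mapP; exists b => //; rewrite mem_filter bq qs.
  by apply/(arrivalsP ok tok); exists (src q), m; rewrite xE.
have aS : a \in S.
  rewrite mem_filter; apply/andP; split.
    by rewrite /s2' /unzip1 map_rcons mem_rcons mem_head.
  have [i [m am]] := aA; apply/(arrivalsP ok tok); exists i, m; split=> //.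
  have s1x : (s.+1 <= x)%N by rewrite xE leq_addr.
  exact: le_trans as1 (horizon_le ok eps0 s1x).
pose S1 := [seq b <- S | fifo_le b a]; pose S2 := [seq b <- S | ~~ fifo_le b a].
have SS : (\sum_(b <- S) len b.2 = \sum_(b <- S1) len b.2 + \sum_(b <- S2) len b.2)%N.
  rewrite [LHS](bigID (fun b : arrival c => fifo_le b a)) /=.
  by congr addn; rewrite -[LHS]big_filter.
have late : (\sum_(b <- S2) len b.2)%:R <= late_bytes.
  apply: le_trans (@sum_after_horizon S2 j s x sx _ _) _.
  - by rewrite filter_uniq.
  - move=> b; rewrite mem_filter => /andP[nba /SP[bA bx _ bj]]; split=> //.
    apply: lt_le_trans sa _; rewrite leNgt; apply: contra nba => ba.
    by rewrite /fifo_le ba.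
  by rewrite xE addSnnS natrD addrAC subrr add0r.
have early : (\sum_(b <- S1) len b.2)%:R <=
    P * (oq_exit tr a - (slot * n0%:R - exit_delay)) + Lmax%:R.
  apply: (oq_exit_work ok tok aA).
  - by rewrite filter_uniq.
  - move=> b; rewrite mem_filter => /andP[ba /SP[bA _ _ bj]].
    by apply/(oq_uptoP ok tok); split.
  - by apply/hasP; exists a; rewrite // mem_filter fifo_le_refl.
  (* By [exit_slot], [b] has been sent by a slot [nb]; as it was still unsent at [n0], it follows
     that [n0 <= nb], which bounds the exit time of [b] from below. *)
  move=> b; rewrite mem_filter => /andP[_ /SP[bA _ bs bj]].
  have [sb [nb [_ _ bout _ be]]] := exit_slot bA.
  rewrite lerBlDr; apply: le_trans be; rewrite ler_pM2l // ler_nat leqNgt.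
  apply/negP => /ltnW nbn; have [t e] := op_sent_prefix eps M tr ok j nbn.
  have /negP[] := s2late _ bs; rewrite e /unzip1 map_cat mem_cat.
  by rewrite bj in bout; rewrite bout.
apply: le_trans dE _; rewrite /line_work.
have -> : \sum_(q <- s2') (len q.1)%:R = (\sum_(q <- s2') len q.1)%:R :> R by rewrite natr_sum.
have w : (\sum_(q <- s2') len q.1)%:R <= P * (oq_exit tr a - (slot * n0%:R - exit_delay)) +
    Lmax%:R + late_bytes.
  apply: (@le_trans _ _ (\sum_(b <- S) len b.2)%:R); first by rewrite ler_nat.
  by rewrite SS natrD lerD.
have : (\sum_(q <- s2') len q.1)%:R / P <= (P * (oq_exit tr a - (slot * n0%:R - exit_delay)) +
    Lmax%:R + late_bytes) / P by rewrite ler_pM2r ?invr_gt0.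
rewrite !mulrDl mulrAC divff ?gt_eqF // mul1r /slot_end /mimic_delay -natr1; lra.
Qed.

End Mimic.

Theorem theorem5 (R : realType) (c : config R) (eps : R) :
  config_ok c -> 0 < eps ->
  exists pol : policy c, forall Lmax : nat, mimics_oq eps pol Lmax.
Proof.
move=> ok eps0; set A := ((cN c * (cN c * ck c + cK c))%:R : R).
have k0 : 0 < (ck c)%:R :> R by rewrite ltr0n (okk ok).
(* The inequality [M_large] solved for [M]. It does not involve [Lmax], so one policy serves all
   packet lengths. *)
pose M := (Num.truncn (A * (1 + eps) / (eps * (ck c)%:R))).+1.
have M_large : A * (1 + eps) <= eps * (ck c)%:R * M%:R.
  by rewrite [leRHS]mulrC -ler_pdivrMr ?mulr_gt0 //; exact/ltW/truncnS_gt.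
(* The [+ 1] makes the inequality strict. *)
exists (periodic_policy c M) => Lmax; exists (mimic_delay c eps M Lmax + 1) => tr tok i n a an.
have [|d dx dl] := exits_in_time ok eps0 tok (ltn0Sn _ : (0 < M)%N) M_large (a := a).
  by exists i, n.
by exists d => //; apply: le_lt_trans dl _; rewrite ltrD2l ltrDl.
Qed.
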